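(* Let $n\in\mathbb N$, $S_1=\mathbb Z\setminus\{0,1,2,\dots,n\}$, $W\in\tilde{\mathcal W}_q([-\pi,\pi))$ and $C_l=\int e_lW^{-1}\,d\lambda$, $l\in\mathbb Z$. Let the $q\times q$ matrices $D_1,\dots,D_n$ be the solutions of the linear system $$\sum_{k=1}^nC_{j-k}D_k^*=C_j,\qquad j=1,\dots,n.$$ Then $$P_{S_1}I=I-\Big(I-\sum_{k=1}^nD_ke_k,\,I\Big)_\sim^{-1}\Big(I-\sum_{k=1}^nD_ke_k\Big)W^{-1},$$ $$\Delta_{S_1}=\Big(I-\sum_{k=1}^nD_ke_k,\,I\Big)_\sim^{-1},$$ and $$\delta_{S_1}=\Big[\det\Big(I-\sum_{k=1}^nD_ke_k,\,I\Big)_\sim\Big]^{-1/q}.$$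
   Context: The group is $\mathbf G=\mathbb Z$, its dual group is identified with $[-\pi,\pi)$ (addition mod $2\pi$), $\lambda$ is normalized Lebesgue measure on $[-\pi,\pi)$, integrals are over $[-\pi,\pi)$, and $e_k(t)=\mathrm e^{ikt}$, $k\in\mathbb Z$. For $q\in\mathbb N=\{1,2,\dots\}$, $\mathbf M_q$ is the algebra of complex $q\times q$ matrices, $I$ the identity matrix (matrices are also viewed as constant functions), $\mathbf M_q'$ the set of matrices of determinant $1$, $\mathrm{tr}$ the normalized trace ($\mathrm{tr}\,I=1$). $\tilde{\mathcal W}_q([-\pi,\pi))$ is the set of integrable functions $W$ on $[-\pi,\pi)$ with values in the positive (definite) Hermitian $q\times q$ matrices such that $W^{-1}$ is integrable. $L^2(W)$ is the left Hilbert $\mathbf M_q$-module of (classes of) measurable $F:[-\pi,\pi)\to\mathbf M_q$ with $\mathrm{tr}(FWF^* )$ integrable, with $\mathbf M_q$-valued inner product $(F,G)=\int FWG^*\,d\lambda$ and norm $\|F\|=(\mathrm{tr}(F,F))^{1/2}$. The $\mathbf M_q$-valued inner product of $L^2(W^{-1})$ is $(F,G)_\sim=\int FW^{-1}G^*\,d\lambda$. For $S\subseteq\mathbb Z\setminus\{0\}$: $\mathcal M(S)$ is the closure in $L^2(W)$ of the set of finite sums $\sum_{k\in S}A_ke_k$ with $A_k\in\mathbf M_q$; $P_S$ is the orthogonal projection of $L^2(W)$ onto $\mathcal M(S)$; $\Delta_S=(I-P_SI,I-P_SI)$; and $\delta_S=\inf\{\|A-F\|^2:A\in\mathbf M_q',\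 F\in\mathcal M(S)\}$. *)

(* Defs.v *)
From HB Require Import structures.
From mathcomp Require Import all_boot all_order all_algebra spectral.
From mathcomp Require Import complex.
From mathcomp Require Import all_classical all_reals all_analysis.

Set Implicit Arguments.
Unset Strict Implicit.
Unset Printing Implicit Defensive.

Import Order.TTheory GRing.Theory Num.Theory.

Local Open Scope classical_set_scope.
Local Open Scope sesquilinear_scope.
Local Open Scope ring_scope.

Section Scalar.
Variable R : realType.

Definition circle : set R := `[(- pi)%R, (pi : R)[.

Fact inv2pi_ge0 : 0 <= (2 * pi : R)^-1.
Proof. by rewrite invr_ge0 mulr_ge0// pi_ge0. Qed.

(* Restricting the domain of integration to [circle] makes this a probability. *)
Definition lam : {measure set (measurableTypeR R) -> \bar R} :=
  mscale (NngNum inv2pi_ge0) (@lebesgue_measure R).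

Definition cmeasurable (f : R -> R[i]) : Prop :=
  measurable_fun circle (fun t => complex.Re (f t)) /\
  measurable_fun circle (fun t => complex.Im (f t)).

Definition cintegrable (f : R -> R[i]) : Prop :=
  lam.-integrable circle (fun t => (complex.Re (f t))%:E) /\
  lam.-integrable circle (fun t => (complex.Im (f t))%:E).

Definition cint (f : R -> R[i]) : R[i] :=
  Complex (\int[lam]_(t in circle) complex.Re (f t))
          (\int[lam]_(t in circle) complex.Im (f t)).

Definition expi (k : int) (t : R) : R[i] :=
  Complex (cos (k%:~R * t)) (sin (k%:~R * t)).

End Scalar.

Section Matrix.
Variables (R : realType) (q : nat).
Local Notation M := 'M[R[i]]_q.

Definition mxmeasurable (F : R -> M) : Prop :=
  forall i j, cmeasurable (fun t => F t i j).

Definition mxintegrable (F : R -> M) : Prop :=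
  forall i j, cintegrable (fun t => F t i j).

Definition mxint (F : R -> M) : M := \matrix_(i, j) cint (fun t => F t i j).

Definition ntr (A : M) : R[i] := q%:R^-1 * \tr A.

(* Over R[i], [0 < z] says that z is real and positive. *)
Definition posdefmx (A : M) : Prop :=
  A \is hermsymmx /\
  forall u : 'rV[R[i]]_q, u != 0 -> 0 < (u *m A *m u ^t*) ord0 ord0.

Definition weight (W : R -> M) : Prop :=
  [/\ forall t, circle t -> posdefmx (W t),
      mxintegrable W & mxintegrable (fun t => invmx (W t))].

(* Elements of L^2(W) are represented by functions; the only values that matter
   are those on [circle], up to a null set. *)
Definition L2 (W : R -> M) : set (R -> M) :=
  [set F | mxmeasurable F /\ cintegrable (fun t => ntr (F t *m W t *m F t ^t*))].

Definition inner (W F G : R -> M) : M :=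
  mxint (fun t => F t *m W t *m G t ^t*).

Definition inner_inv (W F G : R -> M) : M := inner (fun t => invmx (W t)) F G.

(* [ntr (inner W F F)] is a nonnegative real, so [Re] only changes its type. *)
Definition nrm (W F : R -> M) : R :=
  Num.sqrt (complex.Re (ntr (inner W F F))).

Definition trigpoly (S : set int) : set (R -> M) :=
  [set T | exists s : seq int, exists A : int -> M,
     (forall k, k \in s -> S k) /\
     T = (fun t => \sum_(k <- s) expi k t *: A k)].

Definition Mspace (W : R -> M) (S : set int) : set (R -> M) :=
  [set F | L2 W F /\
     forall eps : R, 0 < eps ->
       exists T, trigpoly S T /\ nrm W (fun t => F t - T t) < eps].

Definition is_orthproj (W : R -> M) (S : set int) (F G : R -> M) : Prop :=
  Mspace W S G /\
  forall H, Mspace W S H -> inner W (fun t => F t - G t) H = 0.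

(* A representative of the class of the projection of F, which is unique only
   almost everywhere. *)
Definition orthproj (W : R -> M) (S : set int) (F : R -> M) : R -> M :=
  xget (fun=> 0) [set G | is_orthproj W S F G].

Definition idf : R -> M := fun=> 1%:M.

Definition Delta (W : R -> M) (S : set int) : M :=
  inner W (fun t => idf t - orthproj W S idf t)
          (fun t => idf t - orthproj W S idf t).

Definition delta (W : R -> M) (S : set int) : R :=
  inf [set x | exists A : M, exists F : R -> M,
    [/\ \det A = 1, Mspace W S F & x = nrm W (fun t => A - F t) ^+ 2]].

Definition Ccoef (W : R -> M) (l : int) : M :=
  mxint (fun t => expi l t *: invmx (W t)).

Definition S1 (n : nat) : set int := [set k | ~~ (0 <= k <= n%:Z)].

Definition Qpoly (n : nat) (D : nat -> M) : R -> M :=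
  fun t => 1%:M - \sum_(1 <= k < n.+1) expi k%:Z t *: D k.

End Matrix.

Arguments lam : clear implicits.
Arguments circle : clear implicits.
Arguments idf {R q}.

(* Main.v *)
Require Import Defs.
From mathcomp Require Import all_boot all_order all_algebra spectral.
From mathcomp Require Import complex.
From mathcomp Require Import all_classical all_reals all_analysis.
From mathcomp Require Import measurable_realfun.
From mathcomp Require Import ring lra.
Set Implicit Arguments.
Unset Strict Implicit.
Unset Printing Implicit Defensive.
Import Order.TTheory GRing.Theory Num.Theory.
Local Open Scope classical_set_scope.
Local Open Scope sesquilinear_scope.
Local Open Scope complex_scope.
Local Open Scope ring_scope.
Import numFieldNormedType.Exports HBNNSimple.

(** Write [Q] for [Qpoly n D = I - sum_k D_k e_k] and [(F, G)] for the inner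
    product of [L^2(W)]. Since [(F, e_j W^-1) = int F e_(-j)], the functions
    [e_j W^-1] represent the Fourier coefficients, and these are therefore
    continuous on [L^2(W)]. The linear system for the [D_k] says that the Fourier
    coefficients [1, ..., n] of [Q W^-1] vanish, and its coefficient [0] is [X].
    Put [G = X^-1 Q W^-1] ([resid] below). Then
    - [G W = X^-1 Q] has frequencies in [{0, ..., n}] only, so that [G] is
      orthogonal to [e_k A] for every other frequency [k] ([resid_orth]);
    - [I - G] has vanishing Fourier coefficients at [0, ..., n].
    So [I - G] is the projection of [I] as soon as the vanishing of finitely many
    Fourier coefficients characterizes the closed span of the other characters
    ([Mspace_cofinite]). That follows from the density of the trigonometric
    polynomials in [L^2(W)] ([mxtrig_dense]): the approximants of a function with
    vanishing coefficients at [0, ..., n] have small coefficients there, and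
    dropping them changes little.

    Density is proved from the bottom up. Half circles [{t | 0 < cos (t - c)}]
    have indicators that are bounded pointwise limits of polynomials in
    [cos (t - c)] ([blim_cos_gt0]); such limits are stable under products and
    complements, hence contain the indicators of all arcs ([blim_ray]).
    Dominated convergence and the pi-lambda theorem give all measurable sets
    ([trig_approx_indic]), simple functions give all bounded functions
    ([trig_approx_bounded]), and truncation gives all of [L^2(W)].

    The matrix [X] equals [(Q W^-1, Q W^-1)], because of the vanishing coefficients
    of [Q W^-1]; it is positive definite because the constant coefficient of [Q]
    is [I] ([X_posdef]). Consequently [Delta = (G, G) = X^-1 X X^-1 = X^-1].

    For [det A = 1] and [F] in the subspace, [A - F] is the sum of [A G] and of an
    element of the subspace, so that [||A - F||^2 >= tr (A X^-1 A^t* )], with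
    equality at [F = A (I - G)]. The infimum of [tr (A X^-1 A^t* )] over the
    matrices of determinant [1] is [det (X^-1) ^ (1/q)], by the inequality between
    the arithmetic and geometric means of the eigenvalues ([root_det_le_ntr]), and
    it is reached when [A] is a multiple of the square root of [X]
    ([root_det_attained]). *)

(** * Integrals of complex functions on the circle *)

Section ComplexIntegral.
Variable R : realType.
Implicit Types (f g : R -> R[i]) (u v : R -> R) (z w : R[i]).

Lemma measurable_circle : measurable (circle R : set (measurableTypeR R)).
Proof. exact: measurable_itv. Qed.
Hint Resolve measurable_circle : core.

Lemma cReD z w : complex.Re (z + w) = complex.Re z + complex.Re w.
Proof. by case: z w => [? ?] []. Qed.
Lemma cImD z w : complex.Im (z + w) = complex.Im z + complex.Im w.
Proof. by case: z w => [? ?] []. Qed.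
Lemma cReM z w : complex.Re (z * w) =
  complex.Re z * complex.Re w - complex.Im z * complex.Im w.
Proof. by case: z w => [? ?] []. Qed.
Lemma cImM z w : complex.Im (z * w) =
  complex.Re z * complex.Im w + complex.Im z * complex.Re w.
Proof. by case: z w => [? ?] []. Qed.
Lemma cReN z : complex.Re (- z) = - complex.Re z.
Proof. by case: z. Qed.
Lemma cImN z : complex.Im (- z) = - complex.Im z.
Proof. by case: z. Qed.
Lemma cReJ z : complex.Re z^* = complex.Re z.
Proof. by case: z. Qed.
Lemma cImJ z : complex.Im z^* = - complex.Im z.
Proof. by case: z. Qed.
Lemma conjCc z : Num.conj z = conjc z.
Proof. by []. Qed.

Lemma cnormc_ge0 z : 0 <= Normc.normc z.
Proof. by case: z => a b; exact: sqrtr_ge0. Qed.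

Lemma ler_ReN z : `|complex.Re z| <= Normc.normc z.
Proof.
case: z => a b /=; rewrite -sqrtr_sqr ler_wsqrtr// lerDl; exact: sqr_ge0.
Qed.

Lemma ler_ImN z : `|complex.Im z| <= Normc.normc z.
Proof.
case: z => a b /=; rewrite -sqrtr_sqr ler_wsqrtr// lerDr; exact: sqr_ge0.
Qed.

Lemma normc_le_ReIm z : Normc.normc z <= `|complex.Re z| + `|complex.Im z|.
Proof.
case: z => a b /=; rewrite -[leRHS]ger0_norm ?addr_ge0// -sqrtr_sqr.
rewrite ler_wsqrtr// sqrrD !real_normK ?num_real//.
by rewrite lerD2r lerDl mulrn_wge0// mulr_ge0.
Qed.

Lemma cnormcJ z : Normc.normc z^* = Normc.normc z.
Proof. by case: z => a b /=; rewrite sqrrN. Qed.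

Lemma cmeasurable_cst z : cmeasurable (fun _ : R => z).
Proof. by split; exact: measurable_cst. Qed.

Lemma cmeasurable_eq f g : (forall t, circle R t -> f t = g t) ->
  cmeasurable f -> cmeasurable g.
Proof.
move=> fg [mr mi]; split.
- by apply: eq_measurable_fun mr => t; rewrite inE => /fg ->.
- by apply: eq_measurable_fun mi => t; rewrite inE => /fg ->.
Qed.

Lemma cmeasurableD f g : cmeasurable f -> cmeasurable g ->
  cmeasurable (fun t => f t + g t).
Proof.
move=> [fr fi] [gr gi]; split.
- by under eq_fun do rewrite cReD; exact: measurable_funD.
- by under eq_fun do rewrite cImD; exact: measurable_funD.
Qed.

Lemma cmeasurableM f g : cmeasurable f -> cmeasurable g ->
  cmeasurable (fun t => f t * g t).
Proof.
move=> [fr fi] [gr gi]; split.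
- by under eq_fun do rewrite cReM; apply: measurable_funB; exact: measurable_funM.
- by under eq_fun do rewrite cImM; apply: measurable_funD; exact: measurable_funM.
Qed.

Lemma cmeasurableJ f : cmeasurable f -> cmeasurable (fun t => Num.conj (f t)).
Proof.
move=> [fr fi]; split.
- by under eq_fun do rewrite conjCc cReJ.
- by under eq_fun do rewrite conjCc cImJ; apply: measurableT_comp fi.
Qed.

Lemma cmeasurable_sum (I : Type) (s : seq I) (F : I -> R -> R[i]) :
  (forall i, cmeasurable (F i)) -> cmeasurable (fun t => \sum_(i <- s) F i t).
Proof.
move=> mF; elim: s => [|i s ih].
  by apply: (cmeasurable_eq _ (cmeasurable_cst 0)) => t _; rewrite big_nil.
by under eq_fun do rewrite big_cons; exact: cmeasurableD.
Qed.

Definition rintegrable u := (lam R).-integrable (circle R) (EFin \o u).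

Lemma cintegrable_meas f : cintegrable f -> cmeasurable f.
Proof.
by case=> fr fi; split; apply/measurable_EFinP; [exact: (measurable_int _ fr)|
  exact: (measurable_int _ fi)].
Qed.

Lemma rintegrableD u v : rintegrable u -> rintegrable v ->
  rintegrable (fun t => u t + v t).
Proof. by move=> iu iv; exact: (integrableD _ iu iv). Qed.

Lemma rintegrableZ (k : R) u : rintegrable u -> rintegrable (fun t => k * u t).
Proof. by move=> iu; exact: (integrableZl _ k iu). Qed.

Lemma rintegrable_norm u : rintegrable u -> rintegrable (fun t => `|u t|).
Proof. by move=> iu; exact: (integrable_norm iu). Qed.

Lemma rintegrable_eq u v : (forall t, circle R t -> u t = v t) ->
  rintegrable u -> rintegrable v.
Proof.
by move=> uv; apply: eq_integrable => // t; rewrite inE /= => /uv ->.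
Qed.

Lemma rintegrable_le u v : measurable_fun (circle R) u -> rintegrable v ->
  (forall t, circle R t -> `|u t| <= v t) -> rintegrable u.
Proof.
move=> mu iv uv; apply: le_integrable iv => //; first exact/measurable_EFinP.
by move=> t ct /=; rewrite lee_fin (le_trans (uv t ct))// ler_norm.
Qed.

Lemma rintegrable_sum (I : Type) (s : seq I) (F : I -> R -> R) :
  (forall i, rintegrable (F i)) -> rintegrable (fun t => \sum_(i <- s) F i t).
Proof.
move=> iF; elim: s => [|i s ih].
  by apply: (rintegrable_eq _ (integrable0 _ _)) => // t _; rewrite /= big_nil.
by under [X in rintegrable X]eq_fun do rewrite big_cons; exact: rintegrableD.
Qed.

Lemma cintegrable_le f u : cmeasurable f -> rintegrable u ->
  (forall t, circle R t -> Normc.normc (f t) <= u t) -> cintegrable f.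
Proof.
move=> [mr mi] iu fu; split.
- by apply: (rintegrable_le mr iu) => t /fu; apply: le_trans; exact: ler_ReN.
- by apply: (rintegrable_le mi iu) => t /fu; apply: le_trans; exact: ler_ImN.
Qed.

Lemma cintegrable_normc f : cintegrable f ->
  rintegrable (fun t => `|complex.Re (f t)| + `|complex.Im (f t)|).
Proof. by move=> [fr fi]; apply: rintegrableD; exact: rintegrable_norm. Qed.

Lemma cintegrable_eq f g : (forall t, circle R t -> f t = g t) ->
  cintegrable f -> cintegrable g.
Proof.
move=> fg [fr fi]; split.
- by apply: (rintegrable_eq _ fr) => t /fg ->.
- by apply: (rintegrable_eq _ fi) => t /fg ->.
Qed.

Lemma cintegrableD f g : cintegrable f -> cintegrable g ->
  cintegrable (fun t => f t + g t).
Proof.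
move=> [fr fi] [gr gi]; split.
- by under eq_fun do rewrite cReD; exact: rintegrableD.
- by under eq_fun do rewrite cImD; exact: rintegrableD.
Qed.

Lemma cintegrableM (C : R) f g : cmeasurable f ->
  (forall t, circle R t -> Normc.normc (f t) <= C) ->
  cintegrable g -> cintegrable (fun t => f t * g t).
Proof.
move=> mf fC ig; apply: (@cintegrable_le _
  (fun t => C * (`|complex.Re (g t)| + `|complex.Im (g t)|))).
- exact: (cmeasurableM mf (cintegrable_meas ig)).
- exact/rintegrableZ/cintegrable_normc.
- move=> t ct; rewrite Normc.normcM ler_pM// ?cnormc_ge0 ?fC//.
  exact: normc_le_ReIm.
Qed.

Lemma cintegrableZ z f : cintegrable f -> cintegrable (fun t => z * f t).
Proof. exact: (@cintegrableM (Normc.normc z) (fun=> z) f (cmeasurable_cst z)). Qed.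

Lemma cintegrable_sum (I : Type) (s : seq I) (F : I -> R -> R[i]) :
  (forall i, cintegrable (F i)) -> cintegrable (fun t => \sum_(i <- s) F i t).
Proof.
move=> iF; elim: s => [|i s ih].
  apply: (@cintegrable_eq (fun=> 0)) => [t _|]; first by rewrite big_nil.
  by split; exact: (integrable0 _ _).
by under [X in cintegrable X]eq_fun do rewrite big_cons; exact: cintegrableD.
Qed.

Lemma cint_eq f g : (forall t, circle R t -> f t = g t) -> cint f = cint g.
Proof.
by move=> fg; congr Complex; apply: eq_Rintegral => t; rewrite inE => /fg ->.
Qed.

Lemma cintD f g : cintegrable f -> cintegrable g ->
  cint (fun t => f t + g t) = cint f + cint g.
Proof.
move=> [fr fi] [gr gi]; rewrite /cint.
under [X in Complex X _]eq_Rintegral do rewrite cReD.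
under [X in Complex _ X]eq_Rintegral do rewrite cImD.
by rewrite !RintegralD.
Qed.

Lemma cintZ z f : cintegrable f -> cint (fun t => z * f t) = z * cint f.
Proof.
case: z => a b [fr fi]; rewrite /cint.
under [X in Complex X _]eq_Rintegral do rewrite cReM/=.
under [X in Complex _ X]eq_Rintegral do rewrite cImM/=.
rewrite RintegralB// ?RintegralD// ?RintegralZl//; exact: rintegrableZ.
Qed.

Lemma cint0 : cint (fun=> 0 : R[i]) = 0.
Proof. by rewrite /cint !Rintegral_cst// !mul0r. Qed.

Lemma cint_sum (I : Type) (s : seq I) (F : I -> R -> R[i]) :
  (forall i, cintegrable (F i)) ->
  cint (fun t => \sum_(i <- s) F i t) = \sum_(i <- s) cint (F i).
Proof.
move=> iF; elim: s => [|i s ih].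
  by rewrite big_nil -[RHS]cint0; apply: cint_eq => t _; rewrite big_nil.
rewrite big_cons -ih -cintD//; last exact: cintegrable_sum.
by apply: cint_eq => t _; rewrite big_cons.
Qed.

Lemma cintJ f : cintegrable f -> cint (fun t => Num.conj (f t)) = Num.conj (cint f).
Proof.
move=> [fr fi]; rewrite /cint conjCc /=.
under [X in Complex X _]eq_Rintegral do rewrite conjCc cReJ/=.
under [X in Complex _ X]eq_Rintegral do rewrite conjCc cImJ/= -mulN1r.
by rewrite RintegralZl// mulN1r.
Qed.

Lemma normc_expi (k : int) (t : R) : Normc.normc (expi k t) = 1.
Proof. by rewrite /= cos2Dsin2 sqrtr1. Qed.

Lemma expiD (j k : int) (t : R) : expi (j + k) t = expi j t * expi k t.
Proof.
by rewrite /expi intrD mulrDl cosD sinD; congr Complex; rewrite // addrC [_ * cos _]mulrC.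
Qed.

Lemma expi0 (t : R) : expi 0 t = 1.
Proof. by rewrite /expi mul0r cos0 sin0. Qed.

Lemma expiN (k : int) (t : R) : expi (- k) t = Num.conj (expi k t).
Proof. by rewrite /expi mulrNz mulNr cosN sinN. Qed.

Lemma cmeasurable_expi (k : int) : cmeasurable (expi k : R -> R[i]).
Proof.
have mk : measurable_fun (circle R) (fun t : R => k%:~R * t).
  by apply: measurable_funM => //; exact: measurable_cst.
split; apply: measurableT_comp mk; apply: continuous_measurable_fun.
- exact: continuous_cos.
- exact: continuous_sin.
Qed.

Lemma lam_circle : lam R (circle R) = 1%E.
Proof.
rewrite /lam /= /mscale /= /circle lebesgue_measure_itv /= lte_fin gtrN ?pi_gt0//.
rewrite -EFinD -EFinM opprK -mulr2n -[X in _ * X]mulr_natl mulVf//.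
by rewrite mulf_neq0// ?gt_eqF// pi_gt0.
Qed.

Lemma rintegrable_cst (a : R) : rintegrable (fun=> a).
Proof.
apply: measurable_bounded_integrable => //; first by rewrite lam_circle ltry.
by exists `|a|; split=> // M aM t _ /=; rewrite ltW.
Qed.

Lemma cintegrable_bounded (C : R) f : cmeasurable f ->
  (forall t, circle R t -> Normc.normc (f t) <= C) -> cintegrable f.
Proof. by move=> mf fC; exact: (cintegrable_le mf (rintegrable_cst C) fC). Qed.

Lemma cint_cst z : cint (fun=> z) = z.
Proof. by case: z => a b; congr Complex; rewrite Rintegral_cst//= lam_circle mulr1. Qed.

End ComplexIntegral.

(** * Polynomial approximation of steps, and trigonometric polynomials *)

Section Density.
Variable R : realType.
Implicit Types (p u v : R -> R).
Local Hint Resolve measurable_circle : core.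

(** Together with [bernoulli_ler], this puts [(1 - y) ^+ m] between [1 - m y] and
    [1 / (1 + m y)]. *)
Lemma exprB1_mul1D_le1 (y : R) (m : nat) : 0 <= y <= 1 ->
  (1 - y) ^+ m * (1 + m%:R * y) <= 1.
Proof.
move=> /andP[y0 y1]; elim: m => [|m ih]; first by rewrite expr0 mul0r addr0 mulr1.
apply: le_trans ih; rewrite exprSr -mulrA ler_wpM2l ?exprn_ge0 ?subr_ge0//.
rewrite -natr1 -subr_ge0.
rewrite (_ : _ - _ = (m%:R + 1) * y ^+ 2); last by ring.
by rewrite mulr_ge0 ?sqr_ge0// addr_ge0.
Qed.

Lemma bernoulli_ler (y : R) (m : nat) : 0 <= y <= 1 ->
  1 - m%:R * y <= (1 - y) ^+ m.
Proof.
move=> /andP[y0 y1]; elim: m => [|m ih]; first by rewrite expr0 mul0r subr0.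
rewrite exprSr; apply: (@le_trans _ _ ((1 - m%:R * y) * (1 - y))).
  rewrite -subr_ge0 -natr1.
  rewrite (_ : _ - _ = m%:R * y ^+ 2); last by ring.
  by rewrite mulr_ge0 ?sqr_ge0.
by rewrite ler_wpM2r ?subr_ge0.
Qed.

Lemma cvg_natM_expr (y : R) : 0 <= y < 1 ->
  n%:R * y ^+ n @[n --> \oo] --> (0 : R).
Proof.
move=> /andP[y0 y1]; pose z := Num.sqrt y.
(* [n * z ^+ n <= 1 / (1 - z)], and another factor [z ^+ n] tends to [0] *)
have z0 : 0 <= z by exact: sqrtr_ge0.
have zz : z ^+ 2 = y by rewrite sqr_sqrtr.
have z1 : z < 1.
  by rewrite -(@ltr_pXn2r _ 2) ?nnegrE// zz expr1n.
have cz : z ^+ n * (1 - z)^-1 @[n --> \oo] --> (0 : R).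
  rewrite -[X in _ --> X](mul0r (1 - z)^-1); apply: cvgMl.
  by apply: cvg_expr; rewrite ger0_norm.
apply: (squeeze_cvgr _ (cvg_cst (0 : R)) cz); apply: nearW => n.
rewrite mulr_ge0 ?exprn_ge0//=.
rewrite -zz exprAC expr2 mulrCA ler_wpM2l ?exprn_ge0//.
rewrite -[leRHS]mul1r ler_pdivlMr ?subr_gt0//.
have := @exprB1_mul1D_le1 (1 - z) n.
rewrite subKr subr_ge0 (ltW z1) lerBlDr lerDl z0 => /(_ isT).
apply: le_trans; rewrite -subr_ge0 (_ : _ - _ = z ^+ n) ?exprn_ge0//.
by ring.
Qed.

(** The polynomials of Brosowski and Deutsch's proof of the Stone-Weierstrass
    theorem: by Bernoulli's inequality they compare with [n (2 x)^n], which tends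
    to [0] for [x < 1/2] and is at least [n] otherwise. The factor [n] in the
    exponent gives the limit [0] at the threshold as well. *)
Lemma cvg_step (x : R) : 0 <= x <= 1 ->
  (1 - x ^+ n) ^+ (n * 2 ^ n) @[n --> \oo] --> ((x < 1 / 2)%R%:R : R).
Proof.
move=> /andP[x0 x1].
have xn n : 0 <= x ^+ n <= 1 by rewrite exprn_ge0// exprn_ile1.
have e n : (n * 2 ^ n)%:R * x ^+ n = n%:R * (2 * x) ^+ n.
  by rewrite natrM natrX exprMn mulrA.
case: ltP => xh; rewrite ?(mulr1n, mulr0n).
- have c1 : 1 - n%:R * (2 * x) ^+ n @[n --> \oo] --> (1 : R).
    rewrite -[X in _ --> X](subr0 1); apply: cvgB; first exact: cvg_cst.
    by apply: cvg_natM_expr; lra.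
  apply: (squeeze_cvgr _ c1 (cvg_cst (1 : R))); apply: nearW => n.
  rewrite -e bernoulli_ler//= exprn_ile1 ?subr_ge0 ?lerBlDr ?lerDl//;
    by case/andP: (xn n).
- have c1 : (n.+1%:R : R)^-1 @[n --> \oo] --> (0 : R) by exact: cvg_harmonic.
  apply: (squeeze_cvgr _ (cvg_cst (0 : R)) c1); apply: nearW => n.
  rewrite exprn_ge0 ?subr_ge0//=; last by case/andP: (xn n).
  rewrite -[leRHS]mul1r ler_pdivlMr ?ltr0n//.
  apply: le_trans (exprB1_mul1D_le1 (n * 2 ^ n) (xn n)).
  rewrite ler_wpM2l ?exprn_ge0 ?subr_ge0//; first by case/andP: (xn n).
  rewrite e -natr1 addrC lerD2l ler_peMr// exprn_ege1//; lra.
Qed.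

Definition ctrig (f : R -> R[i]) : Prop :=
  exists l : seq (int * R[i]), forall t, f t = \sum_(x <- l) x.2 * expi x.1 t.

Definition rtrig p := ctrig (fun t => (p t)%:C).

Lemma ctrig_cst z : ctrig (fun=> z).
Proof. by exists [:: (0, z)] => t; rewrite big_seq1 expi0 mulr1. Qed.

Lemma ctrigD f g : ctrig f -> ctrig g -> ctrig (fun t => f t + g t).
Proof. by move=> [l fl] [l' gl]; exists (l ++ l') => t; rewrite big_cat/= fl gl. Qed.

Lemma ctrigM f g : ctrig f -> ctrig g -> ctrig (fun t => f t * g t).
Proof.
move=> [l fl] [l' gl].
exists [seq (x.1 + y.1, x.2 * y.2) | x <- l, y <- l'] => t.
rewrite big_allpairs_dep fl gl mulr_suml; apply: eq_bigr => x _.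
by rewrite mulr_sumr; apply: eq_bigr => y _; rewrite expiD /= mulrACA.
Qed.

Lemma rtrig_cst a : rtrig (fun=> a).
Proof. exact: ctrig_cst. Qed.

Lemma rtrigD p u : rtrig p -> rtrig u -> rtrig (fun t => p t + u t).
Proof.
by move=> hp hu; rewrite /rtrig; under eq_fun do rewrite rmorphD; exact: ctrigD.
Qed.

Lemma rtrigM p u : rtrig p -> rtrig u -> rtrig (fun t => p t * u t).
Proof.
by move=> hp hu; rewrite /rtrig; under eq_fun do rewrite rmorphM; exact: ctrigM.
Qed.

Lemma rtrigB p u : rtrig p -> rtrig u -> rtrig (fun t => p t - u t).
Proof.
move=> hp hu; under eq_fun do rewrite -mulN1r.
exact/rtrigD/rtrigM/hu/rtrig_cst.
Qed.

Lemma rtrigX p n : rtrig p -> rtrig (fun t => p t ^+ n).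
Proof.
move=> hp; elim: n => [|n ih].
  by under eq_fun do rewrite expr0; exact: rtrig_cst.
by under eq_fun do rewrite exprS; exact: rtrigM.
Qed.

Lemma rtrig_cos c : rtrig (fun t => cos (t - c)).
Proof.
exists [:: (1, Complex (cos c / 2) (- (sin c / 2)));
           (-1, Complex (cos c / 2) (sin c / 2))] => t.
rewrite big_cons big_seq1 /= /expi mulrNz mul1r mulN1r cosN sinN cosB.
apply/eqP; rewrite eq_complex /=; apply/andP; split; apply/eqP; lra.
Qed.

Lemma ctrig_measurable f : ctrig f -> cmeasurable f.
Proof.
move=> [l fl]; apply: (@cmeasurable_eq _ (fun t => \sum_(x <- l) x.2 * expi x.1 t)).
  by move=> t _; rewrite fl.
by apply: cmeasurable_sum => x; apply: cmeasurableM;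
  [exact: cmeasurable_cst|exact: cmeasurable_expi].
Qed.

Lemma ctrig_bounded f : ctrig f -> exists C, forall t, Normc.normc (f t) <= C.
Proof.
move=> [l fl]; exists (\sum_(x <- l) Normc.normc x.2) => t.
rewrite fl; elim: l {fl} => [|x l ih]; first by rewrite !big_nil Normc.normc0.
rewrite !big_cons (le_trans (le_normcD _ _))// lerD//.
by rewrite Normc.normcM normc_expi mulr1.
Qed.

Lemma rtrig_measurable p : rtrig p -> measurable_fun (circle R) p.
Proof. by case/ctrig_measurable. Qed.

Lemma rtrig_bounded p : rtrig p -> exists C, forall t, `|p t| <= C.
Proof.
by move=> /ctrig_bounded[C pC]; exists C => t; apply: le_trans (pC t); exact: (ler_ReN (p t)%:C).
Qed.

End Density.

(** * Approximation of arcs *)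

Section Approx.
Variable R : realType.
Implicit Types (p u v f g : R -> R).
Local Hint Resolve measurable_circle : core.
Local Notation "\int_ t f" := (\int[lam R]_(t in circle R) f)
  (at level 36, t name, f at level 36).

Definition rbounded f := exists C, forall t, circle R t -> `|f t| <= C.

Lemma rintegrableM f g : measurable_fun (circle R) f -> rbounded f ->
  rintegrable g -> rintegrable (fun t => f t * g t).
Proof.
move=> mf [C fC] ig; apply: (@rintegrable_le _ _ (fun t => C * `|g t|)).
- by apply: measurable_funM => //; apply/measurable_EFinP; exact: (measurable_int _ ig).
- exact/rintegrableZ/rintegrable_norm.
- by move=> t ct; rewrite normrM ler_wpM2r// fC.
Qed.

Lemma Rintegral_dominated (f_ : nat -> R -> R) f g :
  (forall n, measurable_fun (circle R) (f_ n)) -> rintegrable g ->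
  (forall n t, circle R t -> `|f_ n t| <= g t) ->
  (forall t, circle R t -> f_ n t @[n --> \oo] --> f t) ->
  measurable_fun (circle R) f /\
  \int_ t (f_ n t) @[n --> \oo] --> (\int_ t (f t)).
Proof.
move=> mf ig fg ff.
have mlim : measurable_fun (circle R) f by exact: measurable_fun_cvg mf ff.
split=> //.
have m1 n : measurable_fun (circle R) (EFin \o f_ n) by exact/measurable_EFinP.
have m2 : measurable_fun (circle R) (EFin \o f) by exact/measurable_EFinP.
have [|||ilim _ cv] := @dominated_convergence _ _ _ (lam R) _
  (@measurable_circle R) (fun n => EFin \o f_ n) (EFin \o f) (EFin \o g) m1 m2.
- by apply: aeW => t ct /=; apply: cvg_EFin; [exact: nearW|exact: ff].
- exact: ig.
- by apply: aeW => t n ct /=; rewrite lee_fin fg.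
apply: (fine_cvg (a := \int_ t (f t))); rewrite /Rintegral fineK//.
exact: integrable_fin_num ilim.
Qed.

(** [f] can be approximated by trigonometric polynomials in the weighted space
    [L^2(w)]; measurability and boundedness make all the integrals finite. *)
Definition trig_approx (w : R -> R) f : Prop :=
  [/\ measurable_fun (circle R) f, rbounded f &
    forall eps, 0 < eps ->
    exists2 p, rtrig p & \int_ t ((f t - p t) ^+ 2 * w t) < eps].

(** Pointwise limits of trigonometric polynomials with values in [[0, 1]]: a
    class that is stable under products for a plain reason, which [trig_approx] is
    not, its approximants being controlled in norm only. *)
Definition blim f : Prop := exists p_ : nat -> R -> R,
  [/\ forall n, rtrig (p_ n), forall n t, circle R t -> 0 <= p_ n t <= 1 &
      forall t, circle R t -> p_ n t @[n --> \oo] --> f t].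

Section Weighted.
Variable w : R -> R.
Hypothesis iw : rintegrable w.
Hypothesis w0 : forall t, circle R t -> 0 <= w t.

Lemma rintegrable_sqrB f g : measurable_fun (circle R) f -> measurable_fun (circle R) g ->
  rbounded f -> rbounded g ->
  rintegrable (fun t => (f t - g t) ^+ 2 * w t).
Proof.
move=> mf mg [C fC] [C' gC]; apply: rintegrableM => //.
  by apply: measurable_funX; exact: measurable_funB.
exists ((C + C') ^+ 2) => t ct; rewrite normrX lerXn2r ?nnegrE//.
  by rewrite addr_ge0// (le_trans _ (fC _ ct), le_trans _ (gC _ ct)).
by rewrite (le_trans (ler_normB _ _))// lerD ?fC ?gC.
Qed.

Lemma rtrig_rbounded p : rtrig p -> rbounded p.
Proof. by move=> /rtrig_bounded[C pC]; exists C. Qed.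

Lemma trig_approx_rtrig p : rtrig p -> trig_approx w p.
Proof.
move=> hp; split; [exact: rtrig_measurable|exact: rtrig_rbounded|].
move=> e e0; exists p => //.
under eq_Rintegral do rewrite subrr expr0n mul0r.
by rewrite Rintegral_cst// mul0r.
Qed.

Lemma Rintegral_sqr_triangle f g h :
  measurable_fun (circle R) f -> measurable_fun (circle R) g ->
  measurable_fun (circle R) h -> rbounded f -> rbounded g -> rbounded h ->
  \int_ t ((f t - h t) ^+ 2 * w t) <=
  2 * \int_ t ((f t - g t) ^+ 2 * w t) + 2 * \int_ t ((g t - h t) ^+ 2 * w t).
Proof.
move=> mf mg mh bf bg bh.
have i1 := rintegrable_sqrB mf mg bf bg; have i2 := rintegrable_sqrB mg mh bg bh.
rewrite -!RintegralZl// -RintegralD//; [|exact: rintegrableZ..].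
apply: le_Rintegral => //; [exact: rintegrable_sqrB|by apply: rintegrableD; exact: rintegrableZ|].
move=> t ct; rewrite !mulrA -mulrDl ler_wpM2r ?w0// -subr_ge0.
rewrite (_ : _ - _ = ((f t - g t) - (g t - h t)) ^+ 2); first exact: sqr_ge0.
by ring.
Qed.

(** Dominated convergence makes the approximable functions stable under bounded
    pointwise limits; this carries the density from polynomials to all
    bounded measurable functions. *)
Lemma trig_approx_lim (f_ : nat -> R -> R) f C :
  (forall n, trig_approx w (f_ n)) -> (forall n t, circle R t -> `|f_ n t| <= C) ->
  (forall t, circle R t -> f_ n t @[n --> \oo] --> f t) -> trig_approx w f.
Proof.
move=> af fC ff.
have mf n : measurable_fun (circle R) (f_ n) by case: (af n).
have bf n : rbounded (f_ n) by exists C; exact: fC.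
have mlim : measurable_fun (circle R) f by exact: measurable_fun_cvg mf ff.
have fC' t : circle R t -> `|f t| <= C.
  move=> ct; have cn : `|f_ n t| @[n --> \oo] --> `|f t| by apply: cvg_norm; exact: ff.
  rewrite -(cvg_lim _ cn)//; apply: limr_le; first by apply: cvgP cn.
  by apply: nearW => n; exact: fC.
have blim : rbounded f by exists C.
split=> // e e0.
have [] := @Rintegral_dominated (fun n t => (f t - f_ n t) ^+ 2 * w t) (fun=> 0)
  (fun t => (C + C) ^+ 2 * w t).
- move=> n; apply: measurable_funM; last first.
    by apply/measurable_EFinP; exact: (measurable_int _ iw).
  by apply: measurable_funX; exact: measurable_funB.
- exact: rintegrableZ.
- move=> n t ct; rewrite normrM (ger0_norm (w0 ct)) ler_wpM2r ?w0//.
  rewrite normrX lerXn2r ?nnegrE//.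
    by rewrite addr_ge0// (le_trans _ (fC' _ ct)).
  by rewrite (le_trans (ler_normB _ _))// lerD ?fC ?fC'.
- move=> t ct; rewrite -[X in _ --> X](mul0r (w t)); apply: cvgMl.
  rewrite -[X in _ --> X](expr0n _ 2) -(subrr (f t)).
  rewrite expr2; under eq_fun do rewrite expr2.
  by apply: cvgM; apply: cvgB; [exact: cvg_cst|exact: ff|exact: cvg_cst|exact: ff].
move=> _; rewrite Rintegral_cst// mul0r => /cvgrPdist_lt /(_ (e / 4)).
rewrite divr_gt0// => /(_ isT) [N _ /(_ N (leqnn N))] /=.
rewrite sub0r normrN => /(le_lt_trans (ler_norm _)) hN.
case: (af N) => _ _ /(_ (e / 4)); rewrite divr_gt0// => /(_ isT) [p hp hpN].
exists p => //.
have mp := rtrig_measurable hp; have bp := rtrig_rbounded hp.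
apply: (le_lt_trans (Rintegral_sqr_triangle mlim (mf N) mp blim (bf N) bp)).
lra.
Qed.

Lemma trig_approxD f g : trig_approx w f -> trig_approx w g -> trig_approx w (fun t => f t + g t).
Proof.
move=> [mf bf hf] [mg bg hg]; split; first exact: measurable_funD.
  case: bf bg => C fC [C' gC]; exists (C + C') => t ct.
  by rewrite (le_trans (ler_normD _ _))// lerD ?fC ?gC.
move=> e e0; have [p hp fp] := hf _ (divr_gt0 e0 (ltr0n _ 4)).
have [q hq gq] := hg _ (divr_gt0 e0 (ltr0n _ 4)).
exists (fun t => p t + q t); first exact: rtrigD.
have mp := rtrig_measurable hp; have mq := rtrig_measurable hq.
have bp := rtrig_rbounded hp; have bq := rtrig_rbounded hq.
have i1 := rintegrable_sqrB mf mp bf bp; have i2 := rintegrable_sqrB mg mq bg bq.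
have hpq := rtrigD hp hq.
apply: (@le_lt_trans _ _ (2 * \int_ t ((f t - p t) ^+ 2 * w t) +
   2 * \int_ t ((g t - q t) ^+ 2 * w t))); last by lra.
rewrite -!RintegralZl// -RintegralD//; [|exact: rintegrableZ..].
apply: le_Rintegral => //; [|by apply: rintegrableD; exact: rintegrableZ|].
  apply: rintegrable_sqrB; [exact: measurable_funD|exact: rtrig_measurable|
    |exact: rtrig_rbounded].
  case: bf bg => C fC [C' gC]; exists (C + C') => t ct.
  by rewrite (le_trans (ler_normD _ _))// lerD ?fC ?gC.
move=> t ct; rewrite !mulrA -mulrDl ler_wpM2r ?w0// -subr_ge0.
rewrite (_ : _ - _ = ((f t - p t) - (g t - q t)) ^+ 2); first exact: sqr_ge0.
by ring.
Qed.

Lemma trig_approxZ a f : trig_approx w f -> trig_approx w (fun t => a * f t).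
Proof.
move=> [mf bf hf]; split; first by apply: measurable_funM => //; exact: measurable_cst.
  by case: bf => C fC; exists (`|a| * C) => t ct; rewrite normrM ler_wpM2l ?fC.
move=> e e0.
have ea : 0 < e / (a ^+ 2 + 1) by rewrite divr_gt0// ltr_wpDl ?sqr_ge0.
have [p hp fp] := hf _ ea.
exists (fun t => a * p t); first by apply: rtrigM => //; exact: rtrig_cst.
under eq_Rintegral do rewrite -mulrBr exprMn -mulrA.
rewrite RintegralZl//; last first.
  by apply: rintegrable_sqrB => //; [exact: rtrig_measurable|exact: rtrig_rbounded].
move: fp; rewrite ltr_pdivlMr ?ltr_wpDl ?sqr_ge0//.
have : 0 <= \int_ t ((f t - p t) ^+ 2 * w t).
  by apply: Rintegral_ge0 => t ct; rewrite mulr_ge0 ?sqr_ge0 ?w0.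
lra.
Qed.

Lemma trig_approx_eq f g : (forall t, circle R t -> f t = g t) ->
  trig_approx w f -> trig_approx w g.
Proof.
move=> fg [mf [C fC] hf]; split.
- by apply: eq_measurable_fun mf => t; rewrite inE => /fg.
- by exists C => t ct; rewrite -fg ?fC.
- move=> e /hf[p hp fp]; exists p => //.
  by under eq_Rintegral => t do [rewrite inE => ct; rewrite -(fg _ ct)].
Qed.

Lemma trig_approx_sum (I : Type) (s : seq I) (F : I -> R -> R) :
  (forall i, trig_approx w (F i)) -> trig_approx w (fun t => \sum_(i <- s) F i t).
Proof.
move=> aF; elim: s => [|i s ih].
  apply: (@trig_approx_eq (fun=> 0)); first by move=> t _; rewrite big_nil.
  exact/trig_approx_rtrig/rtrig_cst.
by under eq_fun do rewrite big_cons; exact: trig_approxD.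
Qed.

Lemma blim_trig_approx f : blim f -> trig_approx w f.
Proof.
move=> [p_ [hp p01 pf]]; apply: (@trig_approx_lim p_ f 1) => //.
- by move=> n; exact: trig_approx_rtrig.
- by move=> n t ct; have /andP[p0 p1] := p01 n t ct; rewrite ger0_norm.
Qed.

End Weighted.

Lemma blim_cst (b : bool) : blim (fun=> b%:R).
Proof.
exists (fun _ _ => b%:R); split.
- by move=> _; exact: rtrig_cst.
- by move=> n t _; rewrite ler0n lern1 leq_b1.
- by move=> t _; exact: cvg_cst.
Qed.

Lemma blimM f g : blim f -> blim g -> blim (fun t => f t * g t).
Proof.
move=> [p [hp p01 pf]] [q [hq q01 qg]].
exists (fun n t => p n t * q n t); split.
- by move=> n; exact: rtrigM.
- move=> n t ct; have /andP[p0 p1] := p01 n t ct; have /andP[q0 q1] := q01 n t ct.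
  by rewrite mulr_ge0//= mulr_ile1.
- by move=> t ct; apply: cvgM; [exact: pf|exact: qg].
Qed.

Lemma blimC f : blim f -> blim (fun t => 1 - f t).
Proof.
move=> [p [hp p01 pf]].
exists (fun n t => 1 - p n t); split.
- by move=> n; apply: rtrigB => //; exact: rtrig_cst.
- by move=> n t ct; have /andP[p0 p1] := p01 n t ct; rewrite subr_ge0 p1 lerBlDr lerDl.
- by move=> t ct; apply: cvgB; [exact: cvg_cst|exact: pf].
Qed.

Lemma blim_eq f g : (forall t, circle R t -> f t = g t) -> blim f -> blim g.
Proof.
by move=> fg [p [hp p01 pf]]; exists p; split=> // t ct; rewrite -fg//; exact: pf.
Qed.

Lemma blimU (a b : R -> bool) : blim (fun t => (a t)%:R) -> blim (fun t => (b t)%:R) ->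
  blim (fun t => (a t || b t)%:R).
Proof.
move=> ha hb; apply: (blim_eq _ (blimC (blimM (blimC ha) (blimC hb)))) => t _.
by case: (a t); case: (b t); rewrite /= ?(mulr1n, mulr0n); ring.
Qed.

(** Half circles: a polynomial step applied to [(1 - cos (t - c)) / 2]. *)
Lemma blim_cos_gt0 c : blim (fun t => (0 < cos (t - c))%R%:R).
Proof.
pose x t := (1 - cos (t - c)) / 2.
have hx : rtrig x.
  rewrite /x; under eq_fun do rewrite mulrC.
  apply: rtrigM; first exact: rtrig_cst.
  by apply: rtrigB; [exact: rtrig_cst|exact: rtrig_cos].
have x01 t : 0 <= x t <= 1.
  by have := cos_le1 (t - c); have := cos_geN1 (t - c); rewrite /x; lra.
exists (fun n t => (1 - x t ^+ n) ^+ (n * 2 ^ n)); split.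
- by move=> n; apply: rtrigX; apply: rtrigB; [exact: rtrig_cst|exact: rtrigX].
- move=> n t _; have /andP[x0 x1] := x01 t.
  have h : 0 <= 1 - x t ^+ n <= 1.
    by rewrite subr_ge0 lerBlDr lerDl exprn_ge0// exprn_ile1.
  by case/andP: h => h0 h1; rewrite exprn_ge0//= exprn_ile1.
- move=> t _; rewrite (_ : (0 < cos (t - c)) = (x t < 1 / 2)); first exact: cvg_step.
  by rewrite /x; apply/idP/idP; lra.
Qed.

Lemma blim_sin_gt0 c : blim (fun t => (0 < sin (t - c))%R%:R).
Proof.
apply: (blim_eq _ (blim_cos_gt0 (c + pi / 2))) => t _.
by rewrite opprD addrA cosBpihalf.
Qed.

(** A half line cuts the circle in an arc, which is a Boolean combination of
    half circles. *)
Lemma blim_ray (x : R) : blim (fun t => (x < t)%R%:R).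
Proof.
have pi0 := pi_gt0 R.
have sgt (y : R) : 0 < y -> y < pi -> (0 < sin y) = true.
  by move=> y0 y1; rewrite sin_gt0_pi// y0.
have sle (y : R) : - pi <= y -> y <= 0 -> (0 < sin y) = false.
  move=> y0 y1; apply/negbTE; rewrite -leNgt -[y]opprK sinN oppr_le0.
  by rewrite sin_ge0_pi//; apply/andP; split; lra.
have h0 : blim (fun t : R => (0 < sin t)%R%:R).
  by apply: (blim_eq _ (blim_sin_gt0 0)) => t _; rewrite subr0.
have c0 : blim (fun t : R => (0 < cos t)%R%:R).
  by apply: (blim_eq _ (blim_cos_gt0 0)) => t _; rewrite subr0.
have cE t : circle R t -> - pi <= t /\ t < pi.
  by rewrite /circle /= in_itv /= => /andP.
have [xl|xge] := ltP x (- pi).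
  apply: (blim_eq _ (blim_cst true)) => t /cE[t0 t1].
  by rewrite (lt_le_trans xl t0).
have [xr|xlt] := leP pi x.
  apply: (blim_eq _ (blim_cst false)) => t /cE[t0 t1].
  by rewrite ltNge (le_trans (ltW t1) xr).
have [x0|x0] := leP 0 x.
  apply: (blim_eq _ (blimM h0 (blim_sin_gt0 x))) => t /cE[t0 t1].
  have [xt|tx] := ltP x t.
    by rewrite !sgt ?mulr1//; lra.
  have [t0'|t0'] := leP t 0; first by rewrite sle// mul0r.
  by rewrite (sle (t - x)) ?mulr0//; lra.
have [xpi|xpi] := eqVneq x (- pi).
  apply: (blim_eq _ (blimU (blimU h0 (blim_sin_gt0 x)) c0)) => t /cE[t0 t1].
  rewrite xpi; have [tp|tp] := ltP (- pi) t.
    have [->|] := eqVneq t 0; first by rewrite cos0 ltr01 orbT.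
    rewrite neq_lt => /orP[tn|tp']; last by rewrite sgt.
    by rewrite (sgt (t - - pi)) ?orbT//; lra.
  have -> : t = - pi by apply/eqP; rewrite eq_le tp t0.
  by rewrite subrr sin0 cosN cospi sinN sinpi oppr0 ltxx ltr0N1.
have xgt : - pi < x by rewrite lt_neqAle eq_sym xpi.
apply: (blim_eq _ (blimU h0 (blim_sin_gt0 x))) => t /cE[t0 t1].
have [xt|tx] := ltP x t; last by rewrite !sle//; lra.
have [tp|tp] := ltP t (x + pi); first by rewrite (sgt (t - x)) ?orbT//; lra.
by rewrite (sgt t)//; lra.
Qed.

End Approx.

(** * Approximation of bounded functions; orthogonality of the characters *)

Section Bounded.
Variable R : realType.
Implicit Types (p u v f g : R -> R).
Local Hint Resolve measurable_circle : core.
Local Notation "\int_ t f" := (\int[lam R]_(t in circle R) f)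
  (at level 36, t name, f at level 36).

Section Weighted.
Variable w : R -> R.
Hypothesis iw : rintegrable w.
Hypothesis w0 : forall t, circle R t -> 0 <= w t.

Local Notation T := (measurableTypeR R).

(** The pi-lambda theorem: the sets whose indicator is a [blim] form a pi-system
    that contains the half lines, and the approximable sets form a
    lambda-system. *)
Lemma trig_approx_indic (A : set T) : measurable A -> trig_approx w (\1_A : R -> R).
Proof.
pose G : set (set T) := [set A | measurable A /\ blim (\1_A : R -> R)].
pose H : set (set T) := [set A | measurable A /\ trig_approx w (\1_A : R -> R)].
move=> mA; suff [] : H A by [].
have cst1 : trig_approx w (fun=> 1) by exact/trig_approx_rtrig/rtrig_cst.
have GI : setI_closed G.
  move=> B C [mB GB] [mC GC]; split; first exact: measurableI.
  by apply: (blim_eq _ (blimM GB GC)) => t _; rewrite indicI.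
have HD : lambda_system setT H.
  split => //.
  - by split; [exact: measurableT|rewrite indicT].
  - move=> B C CB [mB aB] [mC aC]; split; first exact: measurableD.
    apply: (@trig_approx_eq _ _ (fun t => \1_B t + -1 * \1_C t)).
      move=> t _; rewrite !indicE in_setD mulN1r.
      have [tC|tC] := boolP (t \in C).
        by rewrite (mem_set (CB _ (set_mem tC))) subrr.
      by rewrite andbT subr0.
    by apply: trig_approxD => //; exact: trig_approxZ.
  - move=> F ndF HF; have mF n : measurable (F n) by case: (HF n).
    split; first by apply: bigcup_measurable => n _; exact: mF.
    apply: (@trig_approx_lim R w iw w0 (fun n => \1_(F n) : R -> R) _ 1).
    + by move=> n; case: (HF n).
    + by move=> n t _; rewrite indicE normr_nat lern1 leq_b1.
    + move=> t _; rewrite !indicE.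
      have [/set_mem[N _ FN]|nF] := boolP (t \in \bigcup_n F n).
        apply: cvg_near_cst; exists N => // n /= Nn; rewrite indicE.
        by rewrite (mem_set ((subsetPset _ _ (ndF _ _ Nn)) _ FN)).
      apply: cvg_near_cst; apply: nearW => n; rewrite indicE.
      rewrite memNset// => Fn; move/negP: nF; apply; apply/mem_set.
      by exists n.
have GH : G `<=` H by move=> B [mB GB]; split=> //; exact: blim_trig_approx.
have := lambda_system_subset GI HD GH (fun _ _ => @subsetT _ _).
apply; have : (@ocitv R).-sigma.-measurable A by [].
rewrite RGenOInfty.measurableE; apply: sub_smallest2r.
  exact: smallest_sigma_algebra.
move=> B [x ->]; split; first exact: measurable_itv.
apply: (blim_eq _ (blim_ray x)) => t _; rewrite indicE.
by rewrite mem_setE in_itv /= andbT.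
Qed.

Lemma trig_approx_bounded f : measurable_fun (circle R) f -> rbounded f -> trig_approx w f.
Proof.
move=> mf [C fC].
have mfC : measurable_fun (circle R) (fun t => (f t + C)%:E).
  by apply/measurable_EFinP; apply: measurable_funD => //; exact: measurable_cst.
have f0 t : circle R t -> (0 <= (f t + C)%:E)%E.
  move=> ct; rewrite lee_fin -lerBlDr sub0r.
  by have := fC t ct; rewrite ler_norml => /andP[].
have [g_ [nd cg]] := approximation (@measurable_circle R) mfC f0.
have cg' t : circle R t -> g_ n t @[n --> \oo] --> f t + C.
  by move=> ct; have := cg t ct; move=> /fine_cvg.
have gE n : trig_approx w (g_ n).
  apply: (@trig_approx_eq _ _ (fun t => \sum_(y \in range (g_ n)) (y * \1_(g_ n @^-1` [set y]) t))).
    by move=> t _; rewrite -fimfunE.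
  under eq_fun do rewrite fsbig_finite//=.
  apply: trig_approx_sum => // y; apply: trig_approxZ => //; apply: trig_approx_indic.
  exact: measurable_funPTI.
have fCa : trig_approx w (fun t => f t + C).
  apply: (@trig_approx_lim _ _ iw w0 (fun n => g_ n : R -> R) _ (C + C)) => // n t ct.
  rewrite ger0_norm ?fun_ge0//.
  apply: (@le_trans _ _ (f t + C)); last first.
    by rewrite lerD2r (le_trans (ler_norm _))// fC.
  have := cg' t ct; move=> /cvg_lim <-//.
  apply: nondecreasing_cvgn_le; last by apply: cvgP; exact: cg'.
  by move=> m k mk; have /lefP := nd _ _ mk; exact.
apply: (@trig_approx_eq _ _ (fun t => (f t + C) + - C)); first by move=> t _; rewrite addrK.
by apply: trig_approxD => //; exact/trig_approx_rtrig/rtrig_cst.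
Qed.

End Weighted.

Lemma lam_FTC (f F : R -> R) : continuous f -> (forall t, 0 <= f t) ->
  (forall t : R, is_derive t 1 F (f t)) ->
  \int_ t (f t) = (2 * pi)^-1 * (F pi - F (- pi)).
Proof.
move=> cf f0 dF.
have mf : measurable_fun (circle R) (EFin \o f).
  by apply/measurable_EFinP; apply: measurable_funTS; exact: continuous_measurable_fun.
have cF : continuous F.
  by move=> t; apply: differentiable_continuous; apply/derivable1_diffP; case: (dF t).
have pp : - pi < (pi : R) by rewrite gtrN ?pi_gt0.
rewrite /Rintegral /lam ge0_integral_mscale//=; last by move=> t _; rewrite lee_fin.
rewrite /circle integral_itv_bndo_bndc; last first.
  by apply: measurable_funTS; apply/measurable_EFinP; exact: continuous_measurable_fun.
rewrite (@continuous_FTC2 _ f F)//.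
- exact: continuous_subspaceT.
- split.
  + by move=> t _; case: (dF t).
  + by apply: cvg_at_right_filter; exact: cF.
  + by apply: cvg_at_left_filter; exact: cF.
- by move=> t _; rewrite derive1E; apply: derive_val.
- exact: measurable_circle.
Qed.

Lemma cint_expi (k : int) : cint (expi k : R -> R[i]) = (k == 0)%:R.
Proof.
have [->|k0] := eqVneq k 0.
  by rewrite -[RHS](cint_cst (1 : R[i])); apply: cint_eq => t _; rewrite expi0.
have kr : k%:~R != 0 :> R by rewrite intr_eq0.
have ic : rintegrable (fun t : R => cos (k%:~R * t)).
  by have [] : cintegrable (expi k : R -> R[i]) by
    apply: (@cintegrable_bounded _ 1); [exact: cmeasurable_expi|move=> t _; rewrite normc_expi].
have is' : rintegrable (fun t : R => sin (k%:~R * t)).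
  by have [] : cintegrable (expi k : R -> R[i]) by
    apply: (@cintegrable_bounded _ 1); [exact: cmeasurable_expi|move=> t _; rewrite normc_expi].
have one : \int_ t (1 : R) = 1 by rewrite Rintegral_cst// lam_circle mulr1.
have p0 : 2 * pi != 0 :> R by rewrite mulf_neq0// gt_eqF// pi_gt0.
have dsin (t : R) : is_derive t 1 (fun s => sin (k%:~R * s)) (k%:~R * cos (k%:~R * t)).
  have : is_derive t 1 (@sin R \o ( *%R k%:~R)) (cos (k%:~R * t) * (k%:~R * 1)).
    exact: is_derive1_comp.
  by rewrite mulr1 mulrC.
have dcos (t : R) : is_derive t 1 (fun s => cos (k%:~R * s)) (- (k%:~R * sin (k%:~R * t))).
  have : is_derive t 1 (@cos R \o ( *%R k%:~R)) (- sin (k%:~R * t) * (k%:~R * 1)).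
    exact: is_derive1_comp.
  by rewrite mulr1 mulrC mulrN.
have snpi (n : nat) : sin (n%:R * pi) = 0 :> R.
  elim: n => [|n ih]; first by rewrite mul0r sin0.
  by rewrite -natr1 mulrDl mul1r sinDpi ih oppr0.
have skpi : sin (k%:~R * pi) = 0 :> R.
  case: (k) => n; first exact: snpi.
  by rewrite NegzE mulrNz mulNr sinN -[_%:~R]/(n.+1%:R) snpi oppr0.
have contD (g g' : R -> R) : (forall t : R, is_derive t 1 g (g' t)) ->
    continuous (fun t => 1 + g t).
  move=> dg t; apply: cvgD; first exact: cvg_cst.
  by apply: differentiable_continuous; apply/derivable1_diffP; case: (dg t).
have -> : cint (expi k : R -> R[i]) = 0; last by [].
congr Complex.
(* [1 + cos (k t)] and [1 + sin (k t)] are nonnegative, as [lam_FTC] demands *)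
- have dF (t : R) : is_derive t 1 (fun s => s + k%:~R^-1 * sin (k%:~R * s))
      (1 + cos (k%:~R * t)).
    have := is_deriveD (is_derive_id t 1) (is_deriveZ (k%:~R^-1) (dsin t)).
    by rewrite /GRing.scale/= mulKf.
  have f0 (t : R) : 0 <= 1 + cos (k%:~R * t) by rewrite -lerBlDl sub0r cos_geN1.
  have := lam_FTC (contD _ _ dcos) f0 dF.
  rewrite RintegralD//; last exact: rintegrable_cst.
  rewrite one mulrN sinN skpi oppr0 mulr0 !addr0 opprK (_ : pi + pi = 2 * pi); last by ring.
  rewrite mulVf//; lra.
- have dF (t : R) : is_derive t 1 (fun s => s - k%:~R^-1 * cos (k%:~R * s))
      (1 + sin (k%:~R * t)).
    have := is_deriveB (is_derive_id t 1) (is_deriveZ (k%:~R^-1) (dcos t)).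
    by rewrite /GRing.scale/= mulrN mulKf// opprK.
  have f0 (t : R) : 0 <= 1 + sin (k%:~R * t) by rewrite -lerBlDl sub0r sin_geN1.
  have := lam_FTC (contD _ _ dsin) f0 dF.
  rewrite RintegralD//; last exact: rintegrable_cst.
  rewrite one mulrN cosN (_ : pi - _ - (- pi - _) = 2 * pi); last by ring.
  rewrite mulVf//; lra.
Qed.
End Bounded.

(** * Matrix functions and the quadratic form of the weight at a point *)

Section Matrices.
Variables (R : realType) (q : nat).
Local Notation M := 'M[R[i]]_q.
Implicit Types (A B : M) (F G H : R -> M).
Local Hint Resolve measurable_circle : core.

Lemma adjmxM m n p (A : 'M[R[i]]_(m, n)) (B : 'M[R[i]]_(n, p)) :
  (A *m B) ^t* = B ^t* *m A ^t*.
Proof. by rewrite trmx_mul map_mxM. Qed.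

Lemma adjmxD m n (A B : 'M[R[i]]_(m, n)) : (A + B) ^t* = A ^t* + B ^t*.
Proof. by rewrite linearD map_mxD. Qed.

Lemma adjmxN m n (A : 'M[R[i]]_(m, n)) : (- A) ^t* = - A ^t*.
Proof. by rewrite linearN map_mxN. Qed.

Lemma adjmxB m n (A B : 'M[R[i]]_(m, n)) : (A - B) ^t* = A ^t* - B ^t*.
Proof. by rewrite adjmxD adjmxN. Qed.

Lemma adjmxZ m n z (A : 'M[R[i]]_(m, n)) : (z *: A) ^t* = Num.conj z *: A ^t*.
Proof. by rewrite linearZ map_mxZ. Qed.

Lemma adjmx1 n : (1%:M : 'M[R[i]]_n) ^t* = 1%:M.
Proof. by rewrite trmx1 map_mx1. Qed.

Lemma adjmxE m n (A : 'M[R[i]]_(m, n)) i j : (A ^t*) i j = Num.conj (A j i).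
Proof. by rewrite !mxE. Qed.

Lemma hermE n (A : 'M[R[i]]_n) : A \is hermsymmx -> A ^t* = A.
Proof. by move=> /is_hermitianmxP; rewrite expr0 scale1r => <-. Qed.

Lemma cReZ (a : R) (z : R[i]) : complex.Re (a%:C * z) = a * complex.Re z.
Proof. by rewrite cReM /= mul0r subr0. Qed.

Lemma mxmeasurable_eq F G : (forall t, circle R t -> F t = G t) ->
  mxmeasurable F -> mxmeasurable G.
Proof. by move=> FG mF i j; apply: cmeasurable_eq (mF i j) => t /FG ->. Qed.

Lemma mxmeasurable_cst A : mxmeasurable (fun _ : R => A).
Proof. by move=> i j; exact: cmeasurable_cst. Qed.

Lemma mxmeasurableD F G : mxmeasurable F -> mxmeasurable G ->
  mxmeasurable (fun t => F t + G t).
Proof. by move=> mF mG i j; under eq_fun do rewrite mxE; exact: cmeasurableD. Qed.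

Lemma mxmeasurableZ (z : R -> R[i]) F : cmeasurable z -> mxmeasurable F ->
  mxmeasurable (fun t => z t *: F t).
Proof. by move=> mz mF i j; under eq_fun do rewrite mxE; exact: cmeasurableM. Qed.

Lemma mxmeasurableB F G : mxmeasurable F -> mxmeasurable G ->
  mxmeasurable (fun t => F t - G t).
Proof.
move=> mF mG; under eq_fun do rewrite -scaleN1r.
by apply: mxmeasurableD => //; apply: mxmeasurableZ => //; exact: cmeasurable_cst.
Qed.

Lemma mxmeasurableM F G : mxmeasurable F -> mxmeasurable G ->
  mxmeasurable (fun t => F t *m G t).
Proof.
move=> mF mG i j; under eq_fun do rewrite mxE.
by apply: cmeasurable_sum => k; exact: cmeasurableM.
Qed.

Lemma mxmeasurableJ F : mxmeasurable F -> mxmeasurable (fun t => F t ^t*).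
Proof. by move=> mF i j; under eq_fun do rewrite adjmxE; exact: cmeasurableJ. Qed.

Lemma mxmeasurable_sum (I : Type) (s : seq I) (F : I -> R -> M) :
  (forall k, mxmeasurable (F k)) -> mxmeasurable (fun t => \sum_(k <- s) F k t).
Proof.
move=> mF i j; under eq_fun do rewrite summxE.
by apply: cmeasurable_sum => k; exact: mF.
Qed.

Lemma mxintegrable_meas F : mxintegrable F -> mxmeasurable F.
Proof. by move=> iF i j; exact: cintegrable_meas. Qed.

Lemma mxintegrable_eq F G : (forall t, circle R t -> F t = G t) ->
  mxintegrable F -> mxintegrable G.
Proof. by move=> FG iF i j; apply: cintegrable_eq (iF i j) => t /FG ->. Qed.

Lemma mxintegrableMl A F : mxintegrable F -> mxintegrable (fun t => A *m F t).
Proof.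
move=> iF i j; under eq_fun do rewrite mxE.
by apply: cintegrable_sum => k; exact: cintegrableZ.
Qed.

Lemma mxintegrableMr A F : mxintegrable F -> mxintegrable (fun t => F t *m A).
Proof.
move=> iF i j; under eq_fun do rewrite mxE.
apply: cintegrable_sum => k; under eq_fun do rewrite mulrC.
exact: cintegrableZ.
Qed.

Lemma mxint_eq F G : (forall t, circle R t -> F t = G t) -> mxint F = mxint G.
Proof. by move=> FG; apply/matrixP => i j; rewrite !mxE; apply: cint_eq => t /FG ->. Qed.

Lemma mxintD F G : mxintegrable F -> mxintegrable G ->
  mxint (fun t => F t + G t) = mxint F + mxint G.
Proof.
move=> iF iG; apply/matrixP => i j; rewrite !mxE -cintD//.
by apply: cint_eq => t _; rewrite mxE.
Qed.

Lemma mxintMl A F : mxintegrable F -> mxint (fun t => A *m F t) = A *m mxint F.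
Proof.
move=> iF; apply/matrixP => i j; rewrite !mxE.
under [RHS]eq_bigr do rewrite mxE -cintZ//.
rewrite -cint_sum; last by move=> k; exact: cintegrableZ.
by apply: cint_eq => t _; rewrite mxE.
Qed.

Lemma mxintMr A F : mxintegrable F -> mxint (fun t => F t *m A) = mxint F *m A.
Proof.
move=> iF; apply/matrixP => i j; rewrite !mxE.
under [RHS]eq_bigr do rewrite mxE mulrC -cintZ//.
rewrite -cint_sum; last by move=> k; exact: cintegrableZ.
by apply: cint_eq => t _; rewrite mxE; apply: eq_bigr => k _; rewrite mulrC.
Qed.

Lemma mxintB F G : mxintegrable F -> mxintegrable G ->
  mxint (fun t => F t - G t) = mxint F - mxint G.
Proof.
move=> iF iG; rewrite -[mxint G]mul1mx -mulNmx -mxintMl// -mxintD//.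
  by apply: mxint_eq => t _; rewrite mulNmx mul1mx.
exact: mxintegrableMl.
Qed.

Lemma mxintJ F : mxintegrable F -> mxint (fun t => F t ^t*) = (mxint F) ^t*.
Proof.
move=> iF; apply/matrixP => i j; rewrite adjmxE !mxE -cintJ//.
by apply: cint_eq => t _; rewrite adjmxE.
Qed.

Lemma mxintegrable_sum (I : Type) (s : seq I) (F : I -> R -> M) :
  (forall k, mxintegrable (F k)) -> mxintegrable (fun t => \sum_(k <- s) F k t).
Proof.
move=> iF i j; under eq_fun do rewrite summxE.
by apply: cintegrable_sum => k; exact: iF.
Qed.

Lemma mxint_sum (I : Type) (s : seq I) (F : I -> R -> M) :
  (forall k, mxintegrable (F k)) ->
  mxint (fun t => \sum_(k <- s) F k t) = \sum_(k <- s) mxint (F k).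
Proof.
move=> iF; apply/matrixP => i j; rewrite mxE summxE.
under [RHS]eq_bigr do rewrite mxE.
rewrite -cint_sum; last by move=> k; exact: iF.
by apply: cint_eq => t _; rewrite summxE.
Qed.

Lemma mxint_cst A : mxint (fun=> A) = A.
Proof. by apply/matrixP => i j; rewrite mxE cint_cst. Qed.

Lemma cintegrable_ntr F : mxintegrable F -> cintegrable (fun t => ntr (F t)).
Proof. by move=> iF; apply: cintegrableZ; apply: cintegrable_sum => i; exact: iF. Qed.

Lemma cint_ntr F : mxintegrable F -> cint (fun t => ntr (F t)) = ntr (mxint F).
Proof.
move=> iF; rewrite cintZ; last by apply: cintegrable_sum => i; exact: iF.
rewrite cint_sum; last by move=> i; exact: iF.
by congr (_ * _); apply: eq_bigr => i _; rewrite mxE.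
Qed.

Lemma mxintegrable_bounded (C C' : R) F G H : mxmeasurable F -> mxmeasurable H ->
  (forall t i j, circle R t -> Normc.normc (F t i j) <= C) ->
  (forall t i j, circle R t -> Normc.normc (H t i j) <= C') ->
  mxintegrable G -> mxintegrable (fun t => F t *m G t *m H t).
Proof.
move=> mF mH FC HC iG i j; under eq_fun do rewrite mxE.
apply: cintegrable_sum => k; under eq_fun do rewrite mulrC.
apply: (cintegrableM (C := C')) => //; first by move=> t; exact: HC.
under eq_fun do rewrite mxE; apply: cintegrable_sum => l.
by apply: (cintegrableM (C := C)) => // t; exact: FC.
Qed.

(** The integrand of the square of [nrm]. *)
Definition pnorm2 (W F : M) : R := complex.Re (ntr (F *m W *m F ^t*)).

Definition psdmx (W : M) := W \is hermsymmx /\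
  forall u : 'rV[R[i]]_q, 0 <= (u *m W *m u ^t*) ord0 ord0.

Lemma posdefmx_psd (W : M) : posdefmx W -> psdmx W.
Proof.
move=> [hW pW]; split=> // u; have [->|u0] := eqVneq u 0; last exact/ltW/pW.
by rewrite !mul0mx mxE.
Qed.

Lemma mulmx_adj_entry (W F H : M) i j :
  (F *m W *m H ^t*) i j = (row i F *m W *m (row j H) ^t*) ord0 ord0.
Proof.
rewrite !mxE; apply: eq_bigr => k _; rewrite !mxE; congr (_ * _).
by apply: eq_bigr => l _; rewrite !mxE.
Qed.

Section Form.
Variable W : M.
Hypothesis pW : psdmx W.
Let form (u v : 'rV[R[i]]_q) : R[i] := (u *m W *m v ^t*) ord0 ord0.

Let formC u v : form v u = Num.conj (form u v).
Proof.
rewrite /form -[in RHS]adjmxE !adjmxM trmxCK (hermE (proj1 pW)) mulmxA.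
by [].
Qed.

Let Re_form_ge0 u : 0 <= complex.Re (form u u).
Proof. by have := pW.2 u; rewrite lecE => /andP[]. Qed.

Let Re_form_le u v :
  `|complex.Re (form u v)| <= (complex.Re (form u u) + complex.Re (form v v)) / 2.
Proof.
have eD : form (u + v) (u + v) = form u u + form v v + (form u v + form v u).
  rewrite /form adjmxD !mulmxDl !mulmxDr !mxE; ring.
have eB : form (u - v) (u - v) = form u u + form v v - (form u v + form v u).
  rewrite /form adjmxD adjmxN !mulmxDl !mulmxDr !mulmxN !mulNmx !mxE; ring.
have := Re_form_ge0 (u + v); have := Re_form_ge0 (u - v).
rewrite eD eB (formC u v) !(cReD, cReN) conjCc cReJ ler_norml.
move: (complex.Re (form u u)) (complex.Re (form v v)) (complex.Re (form u v)).
by move=> a b c h1 h2; apply/andP; split; lra.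
Qed.

Let Im_form_le u v :
  `|complex.Im (form u v)| <= (complex.Re (form u u) + complex.Re (form v v)) / 2.
Proof.
have e1 : form ('i%C *: u) v = 'i%C * form u v.
  by rewrite /form -!scalemxAl mxE.
have e2 : form ('i%C *: u) ('i%C *: u) = form u u.
  rewrite /form adjmxZ -scalemxAr -!scalemxAl !mxE mulrA.
  rewrite conjCc (_ : 'i^* * 'i = 1)%C ?mul1r//.
  by apply/eqP; rewrite eq_complex /=; apply/andP; split; apply/eqP; ring.
have := Re_form_le ('i%C *: u) v; rewrite e1 e2 cReM /= mul0r mul1r sub0r normrN.
by [].
Qed.

Lemma Re_diag_ge0 (F : M) i : 0 <= complex.Re ((F *m W *m F ^t*) i i).
Proof. by rewrite mulmx_adj_entry; exact: Re_form_ge0. Qed.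

Lemma Re_ntr A : complex.Re (ntr A) = q%:R^-1 * \sum_i complex.Re (A i i).
Proof.
have -> : ntr A = (q%:R^-1)%:C * \tr A by rewrite /ntr fmorphV rmorph_nat.
rewrite cReZ; congr (_ * _).
by apply: (big_morph _ (fun x y => @cReD R x y)).
Qed.

Lemma pnorm2_ge0 (F : M) : 0 <= pnorm2 W F.
Proof.
rewrite /pnorm2 Re_ntr mulr_ge0 ?invr_ge0//.
by apply: sumr_ge0 => i _; exact: Re_diag_ge0.
Qed.

Lemma Im_ntr0 (F : M) : complex.Im (ntr (F *m W *m F ^t*)) = 0.
Proof.
have : 0 <= ntr (F *m W *m F ^t*).
  rewrite mulr_ge0 ?invr_ge0//; apply: sumr_ge0 => i _.
  by rewrite mulmx_adj_entry; exact: pW.2.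
by rewrite lecE => /andP[/eqP -> _].
Qed.

Hypothesis q0 : (0 < q)%N.

Lemma diag_le_pnorm2 (F : M) i :
  complex.Re ((F *m W *m F ^t*) i i) <= q%:R * pnorm2 W F.
Proof.
rewrite /pnorm2 Re_ntr mulrA divff ?mul1r ?pnatr_eq0 -?lt0n//.
rewrite (bigD1 i)//= lerDl; apply: sumr_ge0 => j _; exact: Re_diag_ge0.
Qed.

(** All the pointwise estimates follow from this form of the Cauchy-Schwarz
    inequality, the positivity of the form at [u + v], [u - v] and [i u + v],
    [i u - v]. *)
Lemma entry_le_pnorm2 (F H : M) i j :
  Normc.normc ((F *m W *m H ^t*) i j) <= q%:R * (pnorm2 W F + pnorm2 W H).
Proof.
apply: (le_trans (normc_le_ReIm _)).
have := diag_le_pnorm2 F i; have := diag_le_pnorm2 H j.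
rewrite !mulmx_adj_entry -!/(form _ _).
have := Re_form_le (row i F) (row j H).
have := Im_form_le (row i F) (row j H).
move: (complex.Re (form (row i F) (row i F))) (complex.Re (form (row j H) (row j H))).
move: (`|_|) (`|_|) (pnorm2 W F) (pnorm2 W H) => *; lra.
Qed.

End Form.

Lemma pnorm2Z (W F : M) z : pnorm2 W (z *: F) = Normc.normc z ^+ 2 * pnorm2 W F.
Proof.
rewrite /pnorm2 adjmxZ -scalemxAr -!scalemxAl /ntr !linearZ /= mulrCA.
rewrite [q%:R^-1 * (_ * _)]mulrCA !mulrA conjCc.
have -> : z^* * z = (Normc.normc z ^+ 2)%:C.
  case: z => a b; rewrite /= sqr_sqrtr ?addr_ge0 ?sqr_ge0//.
  by apply/eqP; rewrite eq_complex /=; apply/andP; split; apply/eqP; ring.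
by rewrite -[in LHS]mulrA cReZ.
Qed.

Lemma ntrD A B : ntr (A + B) = ntr A + ntr B.
Proof. by rewrite /ntr mxtraceD mulrDr. Qed.

Lemma ntrN A : ntr (- A) = - ntr A.
Proof. by rewrite /ntr linearN /= mulrN. Qed.

Lemma pnorm2_parallelogram (W F G : M) :
  pnorm2 W (F + G) + pnorm2 W (F - G) = 2 * pnorm2 W F + 2 * pnorm2 W G.
Proof.
rewrite /pnorm2 adjmxD adjmxB !mulmxBl !mulmxBr !mulmxDl !mulmxDr.
move: (F *m W *m F ^t*) (F *m W *m G ^t*) (G *m W *m F ^t*) (G *m W *m G ^t*).
by move=> a b c d; rewrite opprB !(ntrD, ntrN) !(cReD, cReN); ring.
Qed.

Lemma pnorm2D_le (W F G : M) : psdmx W ->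
  pnorm2 W (F + G) <= 2 * pnorm2 W F + 2 * pnorm2 W G.
Proof.
by move=> pW; rewrite -pnorm2_parallelogram lerDl; exact: pnorm2_ge0.
Qed.

Lemma pnorm2_eq0 (W F : M) : (0 < q)%N -> posdefmx W -> pnorm2 W F = 0 -> F = 0.
Proof.
move=> q0 pW F0; have pW' := posdefmx_psd pW; apply/row_matrixP => i.
rewrite row0; apply/eqP; apply: contraT => /(pW.2 _).
rewrite -mulmx_adj_entry ltcE => /andP[_]; rewrite ltNge.
by have := diag_le_pnorm2 pW' q0 F i; rewrite F0 mulr0 => ->.
Qed.

Definition entrysum (W : M) : R :=
  \sum_i \sum_j (`|complex.Re (W i j)| + `|complex.Im (W i j)|).

Definition frob2 (F : M) : R :=
  \sum_i \sum_j (complex.Re (F i j) ^+ 2 + complex.Im (F i j) ^+ 2).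

Lemma normc2 (z : R[i]) :
  Normc.normc z ^+ 2 = complex.Re z ^+ 2 + complex.Im z ^+ 2.
Proof. by case: z => a b /=; rewrite sqr_sqrtr ?addr_ge0 ?sqr_ge0. Qed.

Lemma entrysum_ge0 (W : M) : 0 <= entrysum W.
Proof. by do 2! apply: sumr_ge0 => ? _; rewrite addr_ge0. Qed.

Lemma normc_le_entrysum (W : M) i j : Normc.normc (W i j) <= entrysum W.
Proof.
apply: (le_trans (normc_le_ReIm _)).
rewrite /entrysum (bigD1 i)//= (bigD1 j)//= -[leRHS]addrA lerDl addr_ge0//.
  by apply: sumr_ge0 => ? _; rewrite addr_ge0.
by do 2! apply: sumr_ge0 => ? _; rewrite addr_ge0.
Qed.

Lemma pnorm2_le_frob2 (W F : M) : (0 < q)%N ->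
  pnorm2 W F <= q%:R * frob2 F * entrysum W.
Proof.
move=> q0; rewrite /pnorm2 Re_ntr.
move: (entrysum W) (entrysum_ge0 W) (normc_le_entrysum W) => w w0 wW.
pose n i j := Normc.normc (F i j).
have n0 i j : 0 <= n i j by exact: cnormc_ge0.
(* termwise [|F_ij| w |F_ik| <= w (|F_ij|^2 + |F_ik|^2) / 2]; [row_eq] sums the bounds
   over [j] and [k] *)
have row_le i : complex.Re ((F *m W *m F ^t*) i i) <=
    \sum_k \sum_j (n i j ^+ 2 + n i k ^+ 2) / 2 * w.
  rewrite mxE (big_morph _ (fun x y => @cReD R x y) (erefl : complex.Re 0 = 0)).
  apply: ler_sum => k _; rewrite mxE mulr_suml.
  rewrite (big_morph _ (fun x y => @cReD R x y) (erefl : complex.Re 0 = 0)).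
  apply: ler_sum => j _; rewrite adjmxE.
  apply: (le_trans (ler_norm _)); apply: (le_trans (ler_ReN _)).
  rewrite !Normc.normcM conjCc cnormcJ -!/(n _ _).
  apply: (@le_trans _ _ (n i j * w * n i k)).
    by rewrite ler_wpM2r// ler_wpM2l.
  rewrite mulrAC ler_wpM2r// ler_pdivlMr// -subr_ge0.
  by rewrite (_ : _ - _ = (n i j - n i k) ^+ 2) ?sqr_ge0//; ring.
have row_eq i : \sum_k \sum_j (n i j ^+ 2 + n i k ^+ 2) / 2 * w =
    q%:R * (\sum_j n i j ^+ 2) * w.
  under eq_bigr do rewrite -!mulr_suml big_split/= sumr_const cardT size_enum_ord.
  rewrite -!mulr_suml big_split/= sumr_const cardT size_enum_ord sumrMnl.
  by rewrite -mulr_natl; field.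
have fE : frob2 F = \sum_i \sum_j n i j ^+ 2.
  by apply: eq_bigr => i _; apply: eq_bigr => j _; rewrite -normc2.
have f0 : 0 <= frob2 F by rewrite fE; do 2! apply: sumr_ge0 => ? _; exact: sqr_ge0.
apply: (@le_trans _ _ (q%:R^-1 * (q%:R * frob2 F * w))).
  rewrite ler_wpM2l ?invr_ge0// fE mulr_sumr mulr_suml; apply: ler_sum => i _.
  by rewrite -row_eq.
rewrite ler_piMl ?mulr_ge0// invf_le1 ?ler1n ?ltr0n//.
Qed.

End Matrices.

(** * The inner product of L2(W) *)

Section WeightedSpace.
Variables (R : realType) (q : nat).
Hypothesis q0 : (0 < q)%N.
Local Notation M := 'M[R[i]]_q.
Implicit Types (A B : M) (F G H : R -> M).
Local Hint Resolve measurable_circle : core.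
Local Notation "\int_ t f" := (\int[lam R]_(t in circle R) f)
  (at level 36, t name, f at level 36).

Lemma posdefmx_unit (A : M) : posdefmx A -> A \in unitmx.
Proof.
move=> pA; rewrite -row_free_unit -kermx_eq0; apply/rowV0P => u /sub_kermxP uA.
apply/eqP; apply: contraT => /(pA.2 _); rewrite uA mul0mx mxE.
by rewrite ltxx.
Qed.

Variable W : R -> M.
Hypothesis hW : weight W.

Lemma weight_meas : mxmeasurable W.
Proof. by case: hW => _ iW _; exact: mxintegrable_meas. Qed.

Lemma weight_psd t : circle R t -> psdmx (W t).
Proof. by case: hW => pW _ _ /pW; exact: posdefmx_psd. Qed.

Lemma weight_unit t : circle R t -> W t \in unitmx.
Proof. by case: hW => pW _ _ /pW; exact: posdefmx_unit. Qed.

Lemma weight_inv_herm t : circle R t -> (invmx (W t)) ^t* = invmx (W t).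
Proof.
move=> ct; have uW := weight_unit ct.
rewrite -[RHS]mul1mx -[X in X *m _]adjmx1 -(mulmxV uW) adjmxM.
by rewrite (hermE (weight_psd ct).1) mulmxK.
Qed.

(** The imaginary part of the integrand vanishes, [W t] being positive. *)
Lemma L2P F : L2 W F <->
  mxmeasurable F /\ rintegrable (fun t => pnorm2 (W t) (F t)).
Proof.
split=> [[mF [iF _]]|[mF iF]]; first by split.
split=> //; split; first exact: iF.
apply: (@rintegrable_eq _ (fun=> 0)); last exact: rintegrable_cst.
by move=> t ct; rewrite Im_ntr0//; exact: weight_psd.
Qed.

Lemma L2_meas F : L2 W F -> mxmeasurable F.
Proof. by case. Qed.

Lemma L2_pnorm2 F : L2 W F -> rintegrable (fun t => pnorm2 (W t) (F t)).
Proof. by move=> /L2P[]. Qed.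

Lemma L2_eq F G : (forall t, circle R t -> F t = G t) -> L2 W F -> L2 W G.
Proof.
move=> FG /L2P[mF iF]; apply/L2P; split; first exact: mxmeasurable_eq mF.
by apply: rintegrable_eq iF => t ct; rewrite FG.
Qed.

Lemma inner_integrable F G : L2 W F -> L2 W G ->
  mxintegrable (fun t => F t *m W t *m G t ^t*).
Proof.
move=> LF LG i j.
apply: (@cintegrable_le _ _ (fun t => q%:R * (pnorm2 (W t) (F t) + pnorm2 (W t) (G t)))).
- have mF := L2_meas LF; have mG := L2_meas LG.
  by apply: mxmeasurableM; [exact: mxmeasurableM mF weight_meas|exact: mxmeasurableJ].
- by apply: rintegrableZ; apply: rintegrableD; exact: L2_pnorm2.
- by move=> t ct; apply: entry_le_pnorm2 => //; exact: weight_psd.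
Qed.

Lemma pnorm2_meas F : mxmeasurable F ->
  measurable_fun (circle R) (fun t => pnorm2 (W t) (F t)).
Proof.
move=> mF; suff [] : cmeasurable (fun t => ntr (F t *m W t *m F t ^t*)) by [].
apply: cmeasurableM; first exact: cmeasurable_cst.
apply: cmeasurable_sum => i.
by apply: mxmeasurableM; [exact: mxmeasurableM mF weight_meas|exact: mxmeasurableJ].
Qed.

Lemma L2D F G : L2 W F -> L2 W G -> L2 W (fun t => F t + G t).
Proof.
move=> /L2P[mF iF] /L2P[mG iG]; apply/L2P.
have mFG := mxmeasurableD mF mG; split; first exact: mFG.
have i2 := rintegrableD (rintegrableZ 2 iF) (rintegrableZ 2 iG).
apply: (rintegrable_le (pnorm2_meas mFG) i2) => t ct.
have pW := weight_psd ct.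
by rewrite ger0_norm ?pnorm2_ge0//; exact: pnorm2D_le.
Qed.

Lemma L2M A F : L2 W F -> L2 W (fun t => A *m F t).
Proof.
move=> LF; have [mF _] := LF.
split; first by apply: mxmeasurableM => //; exact: mxmeasurable_cst.
apply: cintegrable_ntr.
have := mxintegrableMl A (mxintegrableMr (A ^t*) (inner_integrable LF LF)).
by apply: mxintegrable_eq => t ct; rewrite adjmxM !mulmxA.
Qed.

Lemma L2B F G : L2 W F -> L2 W G -> L2 W (fun t => F t - G t).
Proof.
move=> LF LG; have := L2D LF (L2M (- 1%:M) LG).
by apply: L2_eq => t _; rewrite mulNmx mul1mx.
Qed.

Lemma L2_bounded (C : R) F : mxmeasurable F ->
  (forall t i j, circle R t -> Normc.normc (F t i j) <= C) -> L2 W F.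
Proof.
move=> mF FC; split=> //; apply: cintegrable_ntr.
apply: (@mxintegrable_bounded _ _ C C) => //; first exact: mxmeasurableJ.
  by move=> t i j ct; rewrite adjmxE conjCc cnormcJ FC.
by case: hW.
Qed.

(** [F W^-1] has a finite norm for bounded [F] because
    [(F W^-1) W (F W^-1) ^t* = F W^-1 F ^t*] and [W^-1] is integrable. *)
Lemma L2_bounded_inv (C : R) F : mxmeasurable F ->
  (forall t i j, circle R t -> Normc.normc (F t i j) <= C) ->
  L2 W (fun t => F t *m invmx (W t)).
Proof.
move=> mF FC; have [_ _ iWi] := hW.
split; first by apply: mxmeasurableM => //; exact: mxintegrable_meas.
apply: cintegrable_ntr.
have := @mxintegrable_bounded _ _ C C F (fun t => invmx (W t)) (fun t => F t ^t*)
  mF (mxmeasurableJ mF) FC _ iWi.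
have FC' : forall t i j, circle R t -> Normc.normc ((F t ^t*) i j) <= C.
  by move=> t i j ct; rewrite adjmxE conjCc cnormcJ FC.
move=> /(_ FC'); apply: mxintegrable_eq => t ct.
by rewrite adjmxM weight_inv_herm// mulmxKV ?weight_unit// !mulmxA.
Qed.

Lemma inner_eq F G F' G' : (forall t, circle R t -> F t = F' t) ->
  (forall t, circle R t -> G t = G' t) -> inner W F G = inner W F' G'.
Proof. by move=> FF GG; apply: mxint_eq => t ct; rewrite FF ?GG. Qed.

Lemma innerBl F G H : L2 W F -> L2 W G -> L2 W H ->
  inner W (fun t => F t - G t) H = inner W F H - inner W G H.
Proof.
move=> LF LG LH; rewrite /inner -mxintB; try exact: inner_integrable.
by apply: mxint_eq => t _; rewrite !mulmxBl.
Qed.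

Lemma innerMl A F G : L2 W F -> L2 W G ->
  inner W (fun t => A *m F t) G = A *m inner W F G.
Proof.
move=> LF LG; rewrite /inner -mxintMl; last exact: inner_integrable.
by apply: mxint_eq => t _; rewrite !mulmxA.
Qed.

Lemma innerJ F G : L2 W F -> L2 W G -> inner W G F = (inner W F G) ^t*.
Proof.
move=> LF LG; rewrite /inner -mxintJ; last exact: inner_integrable.
apply: mxint_eq => t ct.
by rewrite !adjmxM trmxCK (hermE (weight_psd ct).1) mulmxA.
Qed.

Lemma innerBr F G H : L2 W F -> L2 W G -> L2 W H ->
  inner W F (fun t => G t - H t) = inner W F G - inner W F H.
Proof.
move=> LF LG LH; rewrite (innerJ (L2B LG LH) LF) innerBl//.
by rewrite adjmxB; congr (_ - _); apply/esym; exact: innerJ.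
Qed.

Lemma innerMr A F G : L2 W F -> L2 W G ->
  inner W F (fun t => A *m G t) = inner W F G *m A ^t*.
Proof.
move=> LF LG; rewrite (innerJ (L2M A LG) LF) innerMl//.
by rewrite adjmxM -(innerJ LG LF).
Qed.

Definition sqnorm F := \int_ t (pnorm2 (W t) (F t)).

Lemma sqnorm_ge0 F : 0 <= sqnorm F.
Proof. by apply: Rintegral_ge0 => t ct; apply: pnorm2_ge0; exact: weight_psd. Qed.

Lemma sqnormE F : L2 W F -> sqnorm F = complex.Re (ntr (inner W F F)).
Proof. by move=> LF; rewrite -cint_ntr//; exact: inner_integrable. Qed.

Lemma nrm2E F : L2 W F -> nrm W F ^+ 2 = sqnorm F.
Proof. by move=> LF; rewrite /nrm -sqnormE// sqr_sqrtr ?sqnorm_ge0. Qed.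

Lemma nrm_ltE F e : L2 W F -> 0 < e -> (nrm W F < e) = (sqnorm F < e ^+ 2).
Proof.
by move=> LF e0; rewrite -nrm2E// ltr_pXn2r// nnegrE ?sqrtr_ge0// ltW.
Qed.

Lemma sqnormD_le F G : L2 W F -> L2 W G ->
  sqnorm (fun t => F t + G t) <= 2 * sqnorm F + 2 * sqnorm G.
Proof.
move=> LF LG; have iF := L2_pnorm2 LF; have iG := L2_pnorm2 LG.
apply: (@le_trans _ _
  (\int_ t (2 * pnorm2 (W t) (F t) + 2 * pnorm2 (W t) (G t)))).
  apply: le_Rintegral; [exact: measurable_circle|exact: (L2_pnorm2 (L2D LF LG))|..].
    exact: (rintegrableD (rintegrableZ 2 iF) (rintegrableZ 2 iG)).
  by move=> t ct; apply: pnorm2D_le; exact: weight_psd.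
rewrite (RintegralD (@measurable_circle R) (rintegrableZ 2 iF) (rintegrableZ 2 iG)).
by rewrite (RintegralZl 2 (@measurable_circle R) iF) (RintegralZl 2 (@measurable_circle R) iG).
Qed.

Lemma normc_cint_le (f : R -> R[i]) (u : R -> R) : cintegrable f -> rintegrable u ->
  (forall t, circle R t -> Normc.normc (f t) <= u t) ->
  Normc.normc (cint f) <= 2 * \int_ t (u t).
Proof.
move=> [fr fi] iu fu; apply: (le_trans (normc_le_ReIm _)) => /=.
have h (v : R -> R) : rintegrable v -> (forall t, circle R t -> `|v t| <= u t) ->
    `|\int_ t (v t)| <= \int_ t (u t).
  move=> iv vu; apply: (le_trans (le_normr_Rintegral _ iv)) => //.
  by apply: le_Rintegral => //; exact: rintegrable_norm.
rewrite mulr_natl mulr2n; apply: lerD; apply: h => // t /fu; apply: le_trans.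
- exact: ler_ReN.
- exact: ler_ImN.
Qed.

(** Integrating [|(F W G ^t* )_ij| <= q (|F|^2 / e + e |G|^2)], that is,
    [entry_le_pnorm2] for multiples of [F] and [G], gives an estimate that is
    linear in [e] when the norm of [F] is at most [e]. *)
Lemma inner_small F G e i j : L2 W F -> L2 W G -> 0 < e -> sqnorm F <= e ^+ 2 ->
  Normc.normc (inner W F G i j) <= 2 * q%:R * (1 + sqnorm G) * e.
Proof.
move=> LF LG e0 Fe; have iF := L2_pnorm2 LF; have iG := L2_pnorm2 LG.
rewrite mxE; apply: (@le_trans _ _ (2 * \int_ t
  (q%:R * (e^-1 * pnorm2 (W t) (F t) + e * pnorm2 (W t) (G t))))).
  apply: normc_cint_le.
  - exact: inner_integrable.
  - by apply: rintegrableZ; apply: rintegrableD; exact: rintegrableZ.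
  - move=> t ct; have pW := weight_psd ct.
    pose s := Num.sqrt e; have s0 : 0 < s by rewrite sqrtr_gt0.
    have se : s ^+ 2 = e by rewrite sqr_sqrtr// ltW.
    (* rescaling [F] by [e^(-1/2)] and [G] by [e^(1/2)] *)
    have := entry_le_pnorm2 pW q0 ((s^-1)%:C *: F t) (s%:C *: G t) i j.
    have nC (a : R) : Normc.normc a%:C ^+ 2 = a ^+ 2.
      by rewrite normc2 /= expr0n addr0.
    rewrite !pnorm2Z !nC exprVn se adjmxZ -scalemxAr -!scalemxAl scalerA.
    rewrite conjCc conjc_real -rmorphM /= divff ?gt_eqF// scale1r.
    by [].
have i2 := rintegrableD (rintegrableZ e^-1 iF) (rintegrableZ e iG).
rewrite (RintegralZl _ (@measurable_circle R) i2).
rewrite (RintegralD (@measurable_circle R) (rintegrableZ e^-1 iF) (rintegrableZ e iG)).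
rewrite (RintegralZl e^-1 (@measurable_circle R) iF) (RintegralZl e (@measurable_circle R) iG).
rewrite -/(sqnorm F) -/(sqnorm G).
rewrite !mulrA -!mulrA ler_wpM2l// ler_wpM2l// mulrDl mul1r [X in _ <= _ + X]mulrC lerD2r.
by rewrite ler_pdivrMl// -expr2.
Qed.

Lemma normc_eq0_small (z : R[i]) (C : R) :
  (forall e, 0 < e -> Normc.normc z <= C * e) -> z = 0.
Proof.
move=> h; apply: Normc.eq0_normc; apply/eqP; rewrite eq_le cnormc_ge0 andbT.
apply/ler_addgt0Pr => e e0; rewrite add0r.
have C1 : 0 < `|C| + 1 by rewrite ltr_wpDl.
apply: (le_trans (h (e / (`|C| + 1)) (divr_gt0 e0 C1))).
rewrite mulrCA ler_piMr ?(ltW e0)// ler_pdivrMr// mul1r.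
by rewrite (le_trans (ler_norm _))// lerDl.
Qed.

Lemma inner_closure_eq0 F G : L2 W F -> L2 W G ->
  (forall e, 0 < e -> exists T, [/\ L2 W T, inner W T G = 0 &
     nrm W (fun t => F t - T t) < e]) -> inner W F G = 0.
Proof.
move=> LF LG h; apply/matrixP => i j; rewrite [RHS]mxE.
apply: (@normc_eq0_small _ (2 * q%:R * (1 + sqnorm G))) => e e0.
have [T [LT TG FT]] := h e e0; have LFT := L2B LF LT.
have -> : inner W F G = inner W (fun t => F t - T t) G.
  by rewrite innerBl// TG subr0.
by apply: inner_small => //; rewrite ltW// -nrm_ltE.
Qed.

End WeightedSpace.

(** * Density of the trigonometric polynomials in L2(W) *)

Section TrigDensity.
Variables (R : realType) (q : nat).
Local Notation M := 'M[R[i]]_q.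
Implicit Types (A B : M) (F G H : R -> M).
Local Hint Resolve measurable_circle : core.
Local Notation "\int_ t f" := (\int[lam R]_(t in circle R) f)
  (at level 36, t name, f at level 36).

Lemma Rintegral_sumr (I : Type) (s : seq I) (f : I -> R -> R) :
  (forall i, rintegrable (f i)) ->
  \int_ t (\sum_(i <- s) f i t) = \sum_(i <- s) \int_ t (f i t).
Proof.
move=> fi; elim: s => [|i s ih].
  rewrite big_nil; under eq_Rintegral do rewrite big_nil.
  by rewrite Rintegral_cst// mul0r.
under eq_Rintegral do rewrite big_cons.
by rewrite big_cons -ih RintegralD//; [exact: fi|exact: rintegrable_sum].
Qed.

Definition mxtrig F := exists L : seq (int * M),
  forall t, F t = \sum_(x <- L) expi x.1 t *: x.2.

Lemma mxtrig_sum (I : Type) (s : seq I) (F : I -> R -> M) :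
  (forall i, mxtrig (F i)) -> mxtrig (fun t => \sum_(i <- s) F i t).
Proof.
move=> hF; elim: s => [|i s [L hL]].
  by exists [::] => t; rewrite !big_nil.
have [L' hL'] := hF i; exists (L' ++ L) => t.
by rewrite big_cons big_cat hL' hL.
Qed.

Lemma mxtrig_entries F : (forall i j, ctrig (fun t => F t i j)) -> mxtrig F.
Proof.
move=> hF; have : mxtrig (fun t => \sum_(i : 'I_q) \sum_(j : 'I_q) F t i j *: delta_mx i j).
  apply: mxtrig_sum => i; apply: mxtrig_sum => j; have [l hl] := hF i j.
  exists [seq (x.1, x.2 *: delta_mx i j) | x <- l] => t.
  rewrite big_map hl scaler_suml; apply: eq_bigr => x _ /=.
  by rewrite scalerA mulrC.
by move=> [L hL]; exists L => t; rewrite -hL -matrix_sum_delta.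
Qed.

Lemma mxtrig_uniq F : mxtrig F -> exists (s : seq int) (A : int -> M),
  uniq s /\ F = fun t => \sum_(k <- s) expi k t *: A k.
Proof.
move=> [L hL]; pose s := undup [seq x.1 | x <- L].
exists s, (fun k => \sum_(x <- L | x.1 == k) x.2); split; first exact: undup_uniq.
apply/funext => t; rewrite hL.
under [RHS]eq_bigr => k _.
  rewrite scaler_sumr (eq_bigr (fun x => expi x.1 t *: x.2)); last first.
    by move=> x /eqP->.
  over.
rewrite (exchange_big_dep xpredT)//=; apply: eq_big_seq => x xL.
rewrite (eq_bigl (pred1 x.1)); last by move=> k /=; rewrite eq_sym.
rewrite -big_filter filter_pred1_uniq ?undup_uniq ?big_seq1//.
by rewrite mem_undup map_f.
Qed.

Lemma normc_trig_le (s : seq int) (A : int -> M) t i j :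
  Normc.normc ((\sum_(k <- s) expi k t *: A k) i j) <=
  \sum_(k <- s) Normc.normc (A k i j).
Proof.
rewrite summxE; elim: s => [|k s ih]; first by rewrite !big_nil Normc.normc0.
rewrite !big_cons (le_trans (le_normcD _ _))// lerD//.
by rewrite mxE Normc.normcM normc_expi mul1r.
Qed.

Lemma mxmeasurable_trig (s : seq int) (A : int -> M) :
  mxmeasurable (fun t : R => \sum_(k <- s) expi k t *: A k).
Proof.
apply: mxmeasurable_sum => k; apply: mxmeasurableZ;
  [exact: cmeasurable_expi|exact: mxmeasurable_cst].
Qed.

Lemma trig_bounded (s : seq int) (A : int -> M) : exists C : R, forall t i j,
  circle R t -> Normc.normc ((\sum_(k <- s) expi k t *: A k) i j) <= C.
Proof.
exists (\sum_(k <- s) entrysum (A k)) => t i j _.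
apply: (le_trans (normc_trig_le _ _ _ _ _)); apply: ler_sum => k _.
exact: normc_le_entrysum.
Qed.

Lemma mxint_expi (k : int) A :
  mxint (fun t => expi k t *: A) = (k == 0)%:R *: A.
Proof.
apply/matrixP => i j; rewrite !mxE -cint_expi mulrC -cintZ; last first.
  apply: (@cintegrable_bounded _ 1); first exact: cmeasurable_expi.
  by move=> t _; rewrite normc_expi.
by apply: cint_eq => t _; rewrite mxE mulrC.
Qed.

Lemma mxintegrable_expiZ (k : int) F : mxintegrable F ->
  mxintegrable (fun t => expi k t *: F t).
Proof.
move=> iF i j; under eq_fun do rewrite mxE.
apply: (cintegrableM (C := 1)) => //; first exact: cmeasurable_expi.
by move=> t _; rewrite normc_expi.
Qed.

Lemma trig_coef (s : seq int) (A : int -> M) j : uniq s -> j \in s ->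
  mxint (fun t => expi (- j) t *: \sum_(k <- s) expi k t *: A k) = A j.
Proof.
move=> us js.
rewrite (@mxint_eq _ _ _ (fun t => \sum_(k <- s) expi (k - j) t *: A k)); last first.
  move=> t _; rewrite scaler_sumr; apply: eq_bigr => k _.
  by rewrite scalerA mulrC expiD.
rewrite mxint_sum; last first.
  move=> k; apply: mxintegrable_expiZ => i' j'.
  by apply: (@cintegrable_bounded _ (Normc.normc (A k i' j'))); first exact: cmeasurable_cst.
under eq_bigr do rewrite mxint_expi.
rewrite (bigD1_seq j)//= subrr eqxx scale1r big1 ?addr0// => k kj.
by rewrite subr_eq0 (negPf kj) scale0r.
Qed.

Hypothesis q0 : (0 < q)%N.
Variable W : R -> M.
Hypothesis hW : weight W.

Lemma rintegrable_entrysum : rintegrable (fun t => entrysum (W t)).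
Proof.
case: hW => _ iW _; apply: rintegrable_sum => i; apply: rintegrable_sum => j.
exact: (cintegrable_normc (iW i j)).
Qed.

Lemma L2_trig (s : seq int) (A : int -> M) :
  L2 W (fun t => \sum_(k <- s) expi k t *: A k).
Proof.
by have [C hC] := trig_bounded s A; apply: (L2_bounded hW _ hC); exact: mxmeasurable_trig.
Qed.

Lemma L2_mxtrig F : mxtrig F -> L2 W F.
Proof. by move=> /mxtrig_uniq[s [A [_ ->]]]; exact: L2_trig. Qed.

(** By [pnorm2_le_frob2], it is enough to approximate each entry in [L^2(w)], for
    the scalar weight [w = entrysum W]. *)
Lemma mxtrig_dense_bounded (C : R) F e : mxmeasurable F ->
  (forall t i j, circle R t -> Normc.normc (F t i j) <= C) -> 0 < e ->
  exists2 T, mxtrig T & sqnorm W (fun t => F t - T t) < e.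
Proof.
move=> mF FC e0; pose w t := entrysum (W t).
have iw : rintegrable w := rintegrable_entrysum.
have w0 t : circle R t -> 0 <= w t by move=> _; exact: entrysum_ge0.
(* the real and imaginary parts of the entries are approximated up to [d], and
   [K * d] bounds the total error *)
pose K : R := q%:R * (q%:R * (q%:R * 2)).
have K0 : 0 <= K by rewrite !mulr_ge0.
pose d := e / (K + 1); have K1 : 0 < K + 1 by rewrite ltr_wpDl.
have d0 : 0 < d by rewrite divr_gt0.
have bRe i j : trig_approx w (fun t => complex.Re (F t i j)).
  apply: trig_approx_bounded => //; first by case: (mF i j).
  by exists C => t ct; apply: le_trans (FC t i j ct); exact: ler_ReN.
have bIm i j : trig_approx w (fun t => complex.Im (F t i j)).
  apply: trig_approx_bounded => //; first by case: (mF i j).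
  by exists C => t ct; apply: le_trans (FC t i j ct); exact: ler_ImN.
have hp (x : 'I_q * 'I_q) : exists p : (R -> R) * (R -> R),
  [/\ rtrig p.1, rtrig p.2,
    \int_ t ((complex.Re (F t x.1 x.2) - p.1 t) ^+ 2 * w t) < d &
    \int_ t ((complex.Im (F t x.1 x.2) - p.2 t) ^+ 2 * w t) < d].
  have [_ _ /(_ d d0)[p hp pd]] := bRe x.1 x.2.
  by have [_ _ /(_ d d0)[r hr rd]] := bIm x.1 x.2; exists (p, r).
have [P hP] := choice hp.
pose T t : M := \matrix_(i, j) Complex ((P (i, j)).1 t) ((P (i, j)).2 t).
have hT : mxtrig T.
  apply: mxtrig_entries => i j; have [h1 h2 _ _] := hP (i, j).
  have := ctrigD h1 (ctrigM (ctrig_cst 'i%C) h2); congr ctrig.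
  by apply/funext => t; rewrite mxE [RHS]complexE.
exists T => //.
have iRe i j : rintegrable (fun t => (complex.Re (F t i j) - (P (i, j)).1 t) ^+ 2 * w t).
  have [h1 _ _ _] := hP (i, j); have [m1 b1 _] := bRe i j.
  apply: rintegrable_sqrB => //; [exact: rtrig_measurable|exact: rtrig_rbounded].
have iIm i j : rintegrable (fun t => (complex.Im (F t i j) - (P (i, j)).2 t) ^+ 2 * w t).
  have [_ h1 _ _] := hP (i, j); have [m1 b1 _] := bIm i j.
  apply: rintegrable_sqrB => //; [exact: rtrig_measurable|exact: rtrig_rbounded].
have LFT : L2 W (fun t => F t - T t).
  by apply: L2B => //; [exact: (L2_bounded hW mF FC)|exact: L2_mxtrig].
pose g t := q%:R * \sum_(i : 'I_q) \sum_(j : 'I_q)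
  ((complex.Re (F t i j) - (P (i, j)).1 t) ^+ 2 * w t +
   (complex.Im (F t i j) - (P (i, j)).2 t) ^+ 2 * w t).
have ig0 i : rintegrable (fun t => \sum_(j : 'I_q)
  ((complex.Re (F t i j) - (P (i, j)).1 t) ^+ 2 * w t +
   (complex.Im (F t i j) - (P (i, j)).2 t) ^+ 2 * w t)).
  by apply: rintegrable_sum => j; apply: rintegrableD; [exact: iRe|exact: iIm].
have ig : rintegrable g by apply: rintegrableZ; apply: rintegrable_sum => i; exact: ig0.
apply: (@le_lt_trans _ _ (\int_ t (g t))).
  apply: le_Rintegral => //; first exact: (L2_pnorm2 hW LFT).
  move=> t ct; apply: (le_trans (pnorm2_le_frob2 _ _ q0)).
  rewrite -mulrA ler_wpM2l// /frob2 mulr_suml; apply: ler_sum => i _.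
  rewrite mulr_suml; apply: ler_sum => j _.
  by rewrite !mxE cReD cImD cReN cImN mulrDl.
rewrite RintegralZl//; last by apply: rintegrable_sum => i; exact: ig0.
rewrite Rintegral_sumr//.
apply: (@le_lt_trans _ _ (K * d)); last first.
  by rewrite /d mulrCA -[ltRHS]mulr1 ltr_pM2l// ltr_pdivrMr// mul1r ltrDl.
rewrite /K -mulrA ler_wpM2l//.
apply: (@le_trans _ _ (\sum_(i : 'I_q) q%:R * (2 * d))); last first.
  by rewrite sumr_const cardT size_enum_ord -[leLHS]mulr_natl !mulrA.
apply: ler_sum => i _; rewrite Rintegral_sumr; last first.
  by move=> j; apply: rintegrableD; [exact: iRe|exact: iIm].
apply: (@le_trans _ _ (\sum_(j : 'I_q) 2 * d)); last first.
  by rewrite sumr_const cardT size_enum_ord -[leLHS]mulr_natl.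
apply: ler_sum => j _; rewrite RintegralD//; [|exact: iRe|exact: iIm].
have [_ _ h1 h2] := hP (i, j).
by rewrite mulr_natl mulr2n lerD// ltW.
Qed.

(** Truncation: the part of [F] where its entries exceed [N] has a norm that tends
    to [0] by dominated convergence. *)
Theorem mxtrig_dense F e : L2 W F -> 0 < e ->
  exists2 T, mxtrig T & sqnorm W (fun t => F t - T t) < e.
Proof.
move=> LF e0; have mF := L2_meas LF; have iF := L2_pnorm2 hW LF.
pose S t := entrysum (F t).
have mS : measurable_fun (circle R) S.
  apply: measurable_sum => i; apply: measurable_sum => j.
  by have [mr mi] := mF i j; apply: measurable_funD; exact: measurableT_comp.
pose c (N : nat) t : R := (S t <= N%:R)%R%:R.
have mc N : measurable_fun (circle R) (c N).
  have mY : measurable (circle R `&` S @^-1` `]-oo, N%:R]).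
    by apply: mS => //; exact: measurable_itv.
  have mI : measurable_fun (circle R) (\1_(circle R `&` S @^-1` `]-oo, N%:R]) : R -> R).
    exact: measurable_indic.
  apply: eq_measurable_fun mI => t tc; rewrite indicE in_setI tc /c.
  congr ((nat_of_bool _)%:R) => /=; apply/idP/idP => [/set_mem|SN]; first by rewrite /= in_itv.
  by apply/mem_set; rewrite /= in_itv.
pose FN N t : M := (c N t)%:C *: F t.
have mFN N : mxmeasurable (FN N).
  by apply: mxmeasurableZ => //; split; [exact: mc|exact: measurable_cst].
have bFN N t i j : circle R t -> Normc.normc (FN N t i j) <= N%:R.
  move=> _; rewrite mxE /c; have [SN|SN] := leP (S t) N%:R.
    by rewrite mul1r; apply: le_trans SN; exact: normc_le_entrysum.
  by rewrite mul0r Normc.normc0.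
have eFN N t : pnorm2 (W t) (F t - FN N t) = (1 - c N t) ^+ 2 * pnorm2 (W t) (F t).
  rewrite -[X in X - _]scale1r -scalerBl pnorm2Z normc2.
  by rewrite cReD cImD cReN cImN /= oppr0 addr0 expr0n addr0.
have [] := @Rintegral_dominated R (fun N t => pnorm2 (W t) (F t - FN N t)) (fun=> 0)
  (fun t => pnorm2 (W t) (F t)).
- by move=> N; apply: (pnorm2_meas hW); exact: mxmeasurableB.
- exact: iF.
- move=> N t ct; have p0 := pnorm2_ge0 (weight_psd hW ct) (F t).
  rewrite eFN ger0_norm; last exact: mulr_ge0 (sqr_ge0 _) p0.
  have /andP[c0 c1] : 0 <= 1 - c N t <= 1.
    by rewrite /c; case: (S t <= N%:R); rewrite /= ?subrr ?subr0 ?lexx ?ler01.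
  by rewrite ler_piMl// exprn_ile1.
- move=> t _; apply: cvg_near_cst.
  exists (Num.trunc (S t)).+1 => // N /= SN; rewrite eFN /c.
  have -> : S t <= N%:R.
    apply: ltW; apply: (lt_le_trans (truncnS_gt (S t))).
    by rewrite ler_nat.
  by rewrite subrr expr0n mul0r.
move=> _; rewrite Rintegral_cst// mul0r => /cvgrPdist_lt /(_ (e / 4)).
rewrite divr_gt0// => /(_ isT) [N _ /(_ N (leqnn N))] /=.
rewrite sub0r normrN => /(le_lt_trans (ler_norm _)) hN.
have [T hT TN] := mxtrig_dense_bounded (mFN N) (bFN N) (divr_gt0 e0 (ltr0n _ 4)).
exists T => //.
have LFN : L2 W (FN N) := L2_bounded hW (mFN N) (bFN N).
have LT := L2_mxtrig hT.
have := sqnormD_le hW (L2B q0 hW LF LFN) (L2B q0 hW LFN LT).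
under [X in sqnorm _ X <= _]eq_fun do rewrite addrA subrK.
move=> /le_lt_trans; apply; move: hN TN; rewrite -/(sqnorm W _).
move: (sqnorm W _) (sqnorm W _) => a b; lra.
Qed.

End TrigDensity.

(** * Traces and determinants of positive definite matrices *)

Section PositiveDefinite.
Variables (R : realType) (q : nat).
Hypothesis q0 : (0 < q)%N.
Local Notation C := R[i].
Local Notation M := 'M[C]_q.

Lemma posdefmx_spectral (Y : M) : posdefmx Y -> exists (P : M) (d : 'rV[C]_q),
  [/\ P *m P ^t* = 1%:M, P ^t* *m P = 1%:M, forall i, 0 < d 0 i &
      Y = P ^t* *m diag_mx d *m P].
Proof.
move=> [hY pY]; have := hermitian_normalmx hY => /orthomx_spectralP.
set P := spectralmx Y; set d := spectral_diag Y => eY.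
have uP : P \is unitarymx by exact: spectral_unitarymx.
have PP : P *m P ^t* = 1%:M by exact/unitarymxP.
have PP' : P ^t* *m P = 1%:M by exact: mulmx1C.
have eY' : Y = P ^t* *m diag_mx d *m P by rewrite {1}eY invmx_unitary.
exists P, d; split=> // i.
have -> : d 0 i = (row i P *m Y *m (row i P) ^t*) ord0 ord0.
  have -> : (row i P *m Y *m (row i P) ^t*) ord0 ord0 = (P *m Y *m P ^t*) i i.
    rewrite !mxE; apply: eq_bigr => k _; rewrite !mxE; congr (_ * _).
    by apply: eq_bigr => l _; rewrite !mxE.
  by rewrite eY' !mulmxA PP mul1mx -mulmxA PP mulmx1 mxE eqxx.
apply: pY; apply/eqP => Pi0.
have := congr1 (fun Z : M => Z i i) PP; rewrite !mxE eqxx big1 => [/esym/eqP|k _].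
  by rewrite oner_eq0.
have /rowP/(_ k) := Pi0; rewrite !mxE => ->; exact: mul0r.
Qed.

Lemma det_conj (A Y : M) : \det A = 1 -> \det (A *m Y *m A ^t*) = \det Y.
Proof.
move=> dA; rewrite !det_mulmx dA mul1r det_map_mx det_tr dA.
by rewrite rmorph1 mulr1.
Qed.

Lemma posdefmx_congr (A Y : M) : A \in unitmx -> posdefmx Y -> posdefmx (A *m Y *m A ^t*).
Proof.
move=> uA [hY pY]; split.
  apply/is_hermitianmxP; rewrite expr0 scale1r !trmx_mul !map_mxM trmxCK mulmxA.
  by have := is_hermitianmxP _ _ _ hY; rewrite expr0 scale1r => <-; rewrite ?mulmxA.
move=> u u0.
have -> : u *m (A *m Y *m A ^t*) *m u ^t* = (u *m A) *m Y *m (u *m A) ^t*.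
  by rewrite trmx_mul map_mxM !mulmxA.
apply: pY; apply/eqP => uA0; move/eqP: u0; apply.
by rewrite -[u](mulmxK uA) uA0 mul0mx.
Qed.

Lemma posdefmx_inv (Y : M) : Y \in unitmx -> posdefmx Y -> posdefmx (invmx Y).
Proof.
move=> uY pY; have hY : Y ^t* = Y.
  by have /is_hermitianmxP := pY.1; rewrite expr0 scale1r => <-.
have : posdefmx (invmx Y *m Y *m (invmx Y) ^t*) by apply: posdefmx_congr; rewrite ?unitmx_inv.
rewrite mulVmx// mul1mx (_ : (invmx Y) ^t* = invmx Y)//.
rewrite -[LHS]mul1mx -(mulVmx uY) -mulmxA -[X in _ *m (X *m _)]hY.
by rewrite -map_mxM -trmx_mul mulVmx// trmx1 map_mx1 mulmx1.
Qed.

(** The arithmetic and geometric means of the eigenvalues. *)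
Lemma root_det_le_ntr (Y : M) : posdefmx Y -> q.-root (\det Y) <= ntr Y.
Proof.
move=> /posdefmx_spectral[P [d [PP PP' d0 eY]]].
have trY : \tr Y = \sum_i d 0 i.
  by rewrite eY -mulmxA mxtrace_mulC -mulmxA PP mulmx1 mxtrace_diag.
have detY : \det Y = \prod_i d 0 i.
  by rewrite eY -mulmxA mulmxA !det_mulmx mulrAC -det_mulmx PP' det1 mul1r det_diag.
have t0 : 0 <= ntr Y.
  by rewrite mulr_ge0 ?invr_ge0// trY sumr_ge0// => i _; exact: ltW.
rewrite -[leRHS](exprCK q0)// ler_rootC ?nnegrE ?exprn_ge0//; last first.
  by rewrite detY prodr_ge0// => i _; exact: ltW.
have := @leif_AGM C 'I_q predT (fun i => d 0 i) _.
rewrite cardT size_enum_ord => /(_ (fun i _ => ltW (d0 i))) [h _].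
by rewrite detY /ntr trY mulrC.
Qed.

(** The determinant of [A = sqrt (c Y^-1)] is [1] and [A Y A ^t* = c I], for [c] the
    [q]-th root of [det Y]. *)
Lemma root_det_attained (Y : M) : posdefmx Y ->
  exists2 A : M, \det A = 1 & ntr (A *m Y *m A ^t*) = q.-root (\det Y).
Proof.
move=> /posdefmx_spectral[P [d [PP PP' d0 eY]]].
have detY : \det Y = \prod_i d 0 i.
  by rewrite eY -mulmxA mulmxA !det_mulmx mulrAC -det_mulmx PP' det1 mul1r det_diag.
have dY0 : 0 < \det Y by rewrite detY prodr_gt0.
set c := q.-root (\det Y).
have c0 : 0 < c by rewrite rootC_gt0.
pose a : 'rV[C]_q := \row_i sqrtC (c / d 0 i).
have a0 i : 0 <= a 0 i by rewrite mxE sqrtC_ge0 divr_ge0 ?ltW.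
have aa i : a 0 i ^+ 2 * d 0 i = c by rewrite mxE sqrtCK divfK// gt_eqF.
have detA : \det (P ^t* *m diag_mx a *m P) = \prod_i a 0 i.
  by rewrite !det_mulmx mulrAC -det_mulmx PP' det1 mul1r det_diag.
exists (P ^t* *m diag_mx a *m P).
  rewrite detA; apply/eqP.
  rewrite -(@pexpr_eq1 _ _ 2)// ?prodr_ge0// -prodrXl.
  have : (\prod_i a 0 i ^+ 2) * \det Y = \det Y.
    rewrite {1}detY -big_split/= (eq_bigr (fun=> c)); last by move=> i _; exact: aa.
    by rewrite prodr_const cardT size_enum_ord rootCK.
  move=> h; apply/eqP; apply: (@mulIf _ (\det Y)); first by rewrite gt_eqF.
  by rewrite h mul1r.
have -> : (P ^t* *m diag_mx a *m P) *m Y *m (P ^t* *m diag_mx a *m P) ^t* = c%:M.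
  rewrite eY !trmx_mul !map_mxM trmxCK tr_diag_mx map_diag_mx.
  rewrite (_ : map_mx _ a = a); last first.
    apply/rowP => i; rewrite !mxE; apply/CrealP; rewrite ger0_real//.
    by rewrite sqrtC_ge0 divr_ge0 ?ltW.
  rewrite !mulmxA -[_ *m P *m P ^t*]mulmxA PP mulmx1.
  rewrite -[_ *m P *m P ^t*]mulmxA PP mulmx1.
  rewrite -[_ *m diag_mx a *m diag_mx d]mulmxA mulmx_diag.
  rewrite -[_ *m diag_mx _ *m diag_mx a]mulmxA mulmx_diag.
  have -> : diag_mx (\row_j ((\row_j (a 0 j * d 0 j)) 0 j * a 0 j)) = c%:M.
    apply/matrixP => i j; rewrite !mxE; case: eqVneq => [->|]; last by rewrite !mulr0n.
    by rewrite !mulr1n; apply: etrans (aa j); rewrite !mxE expr2 mulrAC.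
  by rewrite mul_mx_scalar -scalemxAl PP' scalemx1.
by rewrite /ntr mxtrace_scalar -[c *+ q]mulr_natl mulKf// pnatr_eq0 -lt0n.
Qed.

End PositiveDefinite.

(** * Closed spans of cofinitely many characters *)

Section SpectralSubspace.
Variables (R : realType) (q : nat).
Hypothesis q0 : (0 < q)%N.
Local Notation M := 'M[R[i]]_q.
Implicit Types (A B : M) (F G H : R -> M).
Local Hint Resolve measurable_circle : core.
Local Notation "\int_ t f" := (\int[lam R]_(t in circle R) f)
  (at level 36, t name, f at level 36).

Variable W : R -> M.
Hypothesis hW : weight W.

(** These functions represent the Fourier coefficients, see [inner_charinv]. *)
Definition charinv (j : int) (t : R) : M := expi j t *: invmx (W t).

Lemma L2_charinv j : L2 W (charinv j).
Proof.
have m1 : mxmeasurable (fun t => expi j t *: (1%:M : M)).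
  by apply: mxmeasurableZ;
  [exact: cmeasurable_expi|exact: mxmeasurable_cst].
have := @L2_bounded_inv _ _ _ hW 1 _ m1; move=> h.
apply: (L2_eq hW _ (h _)) => [t _|t i k _].
  by rewrite -scalemxAl mul1mx.
rewrite !mxE Normc.normcM normc_expi mul1r.
by case: eqP => _; rewrite ?Normc.normc1 ?Normc.normc0.
Qed.

Lemma inner_charinv j F : inner W F (charinv j) =
  mxint (fun t => expi (- j) t *: F t).
Proof.
apply: mxint_eq => t ct; rewrite adjmxZ weight_inv_herm// -scalemxAr.
by rewrite mulmxK ?weight_unit// expiN.
Qed.

Lemma sqnorm_charinv j : sqnorm W (charinv j) = sqnorm W (charinv 0).
Proof.
apply: eq_Rintegral => t _; rewrite !pnorm2Z.
by rewrite !normc_expi.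
Qed.

Lemma sqnorm_bounded_le (C : R) F : L2 W F -> 0 <= C ->
  (forall t i j, circle R t -> Normc.normc (F t i j) <= C) ->
  sqnorm W F <= q%:R ^+ 3 * (\int_ t (entrysum (W t))) * C ^+ 2.
Proof.
move=> LF C0 FC; have iw := rintegrable_entrysum hW.
apply: (@le_trans _ _ (\int_ t (q%:R ^+ 3 * C ^+ 2 * entrysum (W t)))).
  apply: le_Rintegral => //; first exact: L2_pnorm2.
    exact: rintegrableZ.
  move=> t ct; apply: (le_trans (pnorm2_le_frob2 _ _ q0)).
  rewrite ler_wpM2r ?entrysum_ge0// exprS -mulrA ler_wpM2l//.
  apply: (@le_trans _ _ (\sum_(i : 'I_q) \sum_(j : 'I_q) C ^+ 2)).
    apply: ler_sum => i _; apply: ler_sum => j _; rewrite -normc2.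
    by rewrite lerXn2r ?nnegrE ?cnormc_ge0// FC.
  by rewrite !sumr_const cardT size_enum_ord -[leLHS]mulr_natl -[C ^+ 2 *+ _]mulr_natl expr2 mulrA.
by rewrite RintegralZl// mulrAC.
Qed.

Lemma ltr_sqrD1 (x : R) : 0 < x -> x < (x + 1) ^+ 2.
Proof.
move=> x0; rewrite sqrrD expr1n mulr1 mulr2n -subr_gt0.
rewrite (_ : _ - x = x ^+ 2 + x + 1); last by ring.
by rewrite !addr_gt0// exprn_gt0.
Qed.

(** An approximant of [F] has small coefficients in [s0], by [inner_small] against
    the functions [charinv j]; dropping them leaves a polynomial with frequencies
    in [S]. *)
Lemma Mspace_cofinite (S : set int) (s0 : seq int) F :
  (forall k, k \notin s0 -> S k) -> L2 W F ->
  (forall j, j \in s0 -> mxint (fun t => expi (- j) t *: F t) = 0) ->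
  Mspace W S F.
Proof.
move=> hS LF F0; split=> // eps eps0.
(* when the approximant is at distance [e], its unwanted coefficients are at most
   [c * e], the entries of the part to be dropped at most [b * e], and the square
   of the final distance at most [K * e ^+ 2] *)
pose c := 2 * q%:R * (1 + sqnorm W (charinv 0)).
have c0 : 0 <= c by rewrite mulr_ge0// ?mulr_ge0// addr_ge0// sqnorm_ge0.
pose b := (size s0)%:R * c.
have b0 : 0 <= b by rewrite mulr_ge0.
pose K := 2 + 2 * (q%:R ^+ 3 * (\int_ t (entrysum (W t))) * b ^+ 2).
have I0 : 0 <= \int_ t (entrysum (W t)).
  by apply: Rintegral_ge0 => t _; exact: entrysum_ge0.
have K0 : 0 < K.
  by rewrite ltr_wpDr// mulr_ge0//; apply: mulr_ge0; [exact: mulr_ge0|exact: exprn_ge0].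
pose e := eps / (K + 1); have K1 : 0 < K + 1 by rewrite ltr_wpDl// ltW.
have e0 : 0 < e by rewrite divr_gt0.
have [T0 /mxtrig_uniq[s [A [us ->]]]] := mxtrig_dense q0 hW LF (exprn_gt0 2 e0).
pose T t : M := \sum_(k <- s) expi k t *: A k; rewrite -/T => hT.
have LT : L2 W T := L2_trig hW s A.
have small k i j : k \in s -> k \in s0 -> Normc.normc (A k i j) <= c * e.
  move=> ks ks0.
  have -> : A k = - inner W (fun t => F t - T t) (charinv k).
    rewrite (innerBl q0 hW LF LT (L2_charinv k)) !inner_charinv F0// sub0r opprK.
    by rewrite trig_coef.
  rewrite mxE normcN /c -(sqnorm_charinv k).
  exact: (inner_small q0 hW i j (L2B q0 hW LF LT) (L2_charinv k) e0 (ltW hT)).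
pose s1 := [seq k <- s | k \notin s0]; pose s2 := [seq k <- s | k \in s0].
pose T1 t : M := \sum_(k <- s1) expi k t *: A k.
pose T2 t : M := \sum_(k <- s2) expi k t *: A k.
have eT t : T t = T1 t + T2 t.
  rewrite /T1 /T2 !big_filter /T (bigID (fun k => k \in s0))/= addrC.
  by [].
have L1 : L2 W T1 := L2_trig hW s1 A; have L2' : L2 W T2 := L2_trig hW s2 A.
exists T1; split.
  exists s1, A; split=> // k; rewrite mem_filter => /andP[ks _]; exact: hS.
rewrite (nrm_ltE q0 hW (L2B q0 hW LF L1) eps0).
have bT2 t i j : circle R t -> Normc.normc (T2 t i j) <= b * e.
  move=> _; apply: (le_trans (normc_trig_le _ _ _ _ _)).
  apply: (@le_trans _ _ (\sum_(k <- s2) c * e)).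
    rewrite [leLHS]big_seq [leRHS]big_seq; apply: ler_sum => k.
    by rewrite mem_filter => /andP[ks0 ks]; exact: small.
  rewrite big_const_seq count_predT iter_addr_0 -[leLHS]mulr_natl /b -mulrA.
  rewrite ler_wpM2r ?(mulr_ge0 c0 (ltW e0))// ler_nat uniq_leq_size ?filter_uniq//.
  by move=> k; rewrite mem_filter => /andP[].
have S2 := sqnorm_bounded_le L2' (mulr_ge0 b0 (ltW e0)) bT2.
have eF : (fun t => F t - T1 t) = (fun t => (F t - T t) + T2 t).
  by apply/funext => t; rewrite eT opprD addrA subrK.
rewrite eF; apply: (le_lt_trans (sqnormD_le hW (L2B q0 hW LF LT) L2')).
apply: (@le_lt_trans _ _ (K * e ^+ 2)).
  rewrite exprMn mulrA in S2; rewrite /K.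
  move: (sqnorm W T2) (sqnorm W _) S2 (ltW hT) => x y.
  move: (q%:R ^+ 3 * _ * _) (e ^+ 2) => u v; lra.
rewrite /e expr_div_n mulrA ltr_pdivrMr ?exprn_gt0// mulrC ltr_pM2l ?exprn_gt0//.
exact: ltr_sqrD1.
Qed.

Lemma lam_ae_imply (P P' : R -> Prop) : (forall t, P t -> P' t) ->
  (\forall t \ae lam R, P t) -> \forall t \ae lam R, P' t.
Proof. by move=> PP'; apply: (@filterS _ _ (ae_filter_ringOfSetsType (lam R))). Qed.

Lemma mxint_ae_eq F G : mxmeasurable F -> mxmeasurable G ->
  F = G %[ae lam R in circle R] -> mxint F = mxint G.
Proof.
move=> mF mG FG; apply/matrixP => i j; rewrite mxE [RHS]mxE.
have [fr fi] := mF i j; have [gr gi] := mG i j.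
congr Complex; congr fine; apply: ae_eq_integral => //; try exact/measurable_EFinP.
- by apply: lam_ae_imply FG => t h /h /= ->.
- by apply: lam_ae_imply FG => t h /h /= ->.
Qed.

Lemma inner_ae_eq F G : mxmeasurable F -> mxmeasurable G ->
  F = G %[ae lam R in circle R] -> inner W F F = inner W G G.
Proof.
have mI H : mxmeasurable H -> mxmeasurable (fun t => H t *m W t *m H t ^t*).
  by move=> mH; apply: mxmeasurableM;
    [exact: mxmeasurableM mH (weight_meas hW)|exact: mxmeasurableJ].
move=> mF mG FG; apply: mxint_ae_eq; [exact: mI|exact: mI|].
by apply: lam_ae_imply FG => t h /h ->.
Qed.

Lemma sqnorm_eq0 F : L2 W F -> sqnorm W F = 0 ->
  F = (fun=> 0) %[ae lam R in circle R].
Proof.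
move=> LF F0; have iF := L2_pnorm2 hW LF.
have mF := measurable_int _ iF.
have := ae_eq_integral_abs (lam R) (@measurable_circle R) mF => -[+ _].
have -> : (\int[lam R]_(x in circle R) `|(EFin \o (fun t => pnorm2 (W t) (F t))) x| = 0)%E.
  rewrite -[RHS]/(0%:E) -F0 /sqnorm /Rintegral fineK; last exact: integrable_fin_num iF.
  apply: eq_integral => t; rewrite inE => ct /=.
  by rewrite ger0_norm// pnorm2_ge0//; exact: weight_psd.
move=> /(_ erefl); apply: lam_ae_imply => t h ct.
case: hW => pW _ _; apply: (pnorm2_eq0 q0 (pW t ct)).
by have := h ct => -[].
Qed.

End SpectralSubspace.

(** * The projection of the identity and the distance to the unimodular matrices *)

Section Projection.
Variables (R : realType) (q : nat).
Hypothesis q0 : (0 < q)%N.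
Local Notation M := 'M[R[i]]_q.
Implicit Types (A B : M) (F G H : R -> M).

Variable W : R -> M.
Hypothesis hW : weight W.
Variables (n : nat) (D : nat -> M).
Hypothesis hD : forall j : nat, (1 <= j <= n)%N ->
  \sum_(1 <= k < n.+1) Ccoef W (j%:Z - k%:Z) *m (D k) ^t* = Ccoef W j%:Z.

Local Notation Q := (Qpoly n D).
Local Notation X := (inner_inv W Q idf).

Definition QWinv (t : R) : M := Q t *m invmx (W t).

Lemma Qpoly_meas : mxmeasurable Q.
Proof.
apply: mxmeasurableB; first exact: mxmeasurable_cst.
by apply: mxmeasurable_sum => k; apply: mxmeasurableZ;
  [exact: cmeasurable_expi|exact: mxmeasurable_cst].
Qed.

Lemma Qpoly_bounded : exists C : R, forall t i j,
  circle R t -> Normc.normc (Q t i j) <= C.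
Proof.
exists (1 + \sum_(1 <= k < n.+1) entrysum (D k)) => t i j _.
rewrite mxE (le_trans (le_normcD _ _))// lerD//.
  by rewrite mxE; case: eqP => _; rewrite ?Normc.normc1 ?Normc.normc0.
rewrite mxE normcN summxE.
elim/big_ind2: _ => [|x1 x2 y1 y2 h1 h2|k _]; first by rewrite Normc.normc0.
  by rewrite (le_trans (le_normcD _ _))// lerD.
by rewrite mxE Normc.normcM normc_expi mul1r normc_le_entrysum.
Qed.

Lemma L2_QWinv : L2 W QWinv.
Proof.
have [C hC] := Qpoly_bounded; exact: (L2_bounded_inv hW Qpoly_meas hC).
Qed.

Lemma mxintegrable_Winv k : mxintegrable (fun t => expi k t *: invmx (W t)).
Proof. by apply: mxintegrable_expiZ; case: hW. Qed.

Lemma CcoefJ (k : int) : (Ccoef W k) ^t* = Ccoef W (- k).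
Proof.
rewrite -mxintJ; last exact: mxintegrable_Winv.
by apply: mxint_eq => t ct; rewrite adjmxZ weight_inv_herm// expiN.
Qed.

Lemma coef_QWinvE (j : int) : mxint (fun t => expi (- j) t *: QWinv t) =
  Ccoef W (- j) - \sum_(1 <= k < n.+1) D k *m Ccoef W (k%:Z - j).
Proof.
rewrite (@mxint_eq _ _ _ (fun t => expi (- j) t *: invmx (W t) -
  \sum_(1 <= k < n.+1) D k *m (expi (k%:Z - j) t *: invmx (W t)))); last first.
  move=> t _; rewrite /QWinv /Qpoly mulmxBl mul1mx scalerBr; congr (_ - _).
  rewrite mulmx_suml scaler_sumr; apply: eq_bigr => k _.
  by rewrite -scalemxAl scalerA -scalemxAr expiD mulrC.
rewrite mxintB; first last.
- by apply: mxintegrable_sum => k; apply: mxintegrableMl; exact: mxintegrable_Winv.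
- exact: mxintegrable_Winv.
congr (_ - _); rewrite mxint_sum; last first.
  by move=> k; apply: mxintegrableMl; exact: mxintegrable_Winv.
by apply: eq_bigr => k _; rewrite mxintMl//; exact: mxintegrable_Winv.
Qed.

Lemma coef_QWinv0 : mxint (fun t => expi 0 t *: QWinv t) = X.
Proof.
apply: mxint_eq => t _.
by rewrite expi0 scale1r /idf adjmx1 mulmx1.
Qed.

(** This is the adjoint of the linear system for the [D k]. *)
Lemma coef_QWinv_eq0 (j : nat) : (1 <= j <= n)%N ->
  mxint (fun t => expi (- j%:Z) t *: QWinv t) = 0.
Proof.
move=> jn; rewrite coef_QWinvE -CcoefJ -(hD jn); apply/eqP.
rewrite subr_eq0 raddf_sum/= map_mx_sum; apply/eqP; apply: eq_bigr => k _.
by rewrite adjmxM trmxCK CcoefJ opprB.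
Qed.

Lemma coef_Qpoly (j : int) : mxint (fun t => expi (- j) t *: Q t) =
  (j == 0)%:R *: 1%:M - \sum_(1 <= k < n.+1) (k%:Z == j)%:R *: D k.
Proof.
have ie (k : int) A : mxintegrable (fun t => expi k t *: A).
  apply: mxintegrable_expiZ => i i'.
  by apply: (@cintegrable_bounded _ (Normc.normc (A i i'))); first exact: cmeasurable_cst.
rewrite (@mxint_eq _ _ _ (fun t => expi (- j) t *: 1%:M -
  \sum_(1 <= k < n.+1) expi (k%:Z - j) t *: D k)); last first.
  move=> t _; rewrite scalerBr; congr (_ - _).
  by rewrite scaler_sumr; apply: eq_bigr => k _; rewrite scalerA expiD mulrC.
rewrite mxintB//; last exact: mxintegrable_sum.
rewrite mxint_sum// mxint_expi oppr_eq0; congr (_ - _).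
by apply: eq_bigr => k _; rewrite mxint_expi subr_eq0.
Qed.

Lemma coef_Qpoly0 : mxint Q = 1%:M.
Proof.
rewrite -(@mxint_eq _ _ (fun t => expi (- 0) t *: Q t)); last first.
  by move=> t _; rewrite oppr0 expi0 scale1r.
rewrite coef_Qpoly eqxx scale1r big_nat big1 ?subr0// => k /andP[k1 _].
by rewrite eqz_nat eqn0Ngt k1 scale0r.
Qed.

Lemma coef_Qpoly_eq0 (j : int) : S1 n j -> mxint (fun t => expi (- j) t *: Q t) = 0.
Proof.
rewrite /S1/= => jn; rewrite coef_Qpoly big_nat big1 ?subr0 => [|k /andP[_ kn]].
  by case: eqP jn => [->|_]; rewrite ?scale0r.
case: (eqVneq k%:Z j) => [kj|_]; last by rewrite scale0r.
by exfalso; move: jn; rewrite -kj !lez_nat => /negP; apply.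
Qed.

(** In [Q W^-1 Q ^t*], only the constant term of [Q ^t*] contributes to the integral,
    by [coef_QWinv_eq0]. *)
Lemma inner_QWinv : inner W QWinv QWinv = X.
Proof.
have iQ j : mxintegrable (fun t => expi j t *: QWinv t).
  apply: mxintegrable_expiZ; have [_ _ iWi] := hW; have [C hC] := Qpoly_bounded.
  have := @mxintegrable_bounded _ _ C 1 _ _ _ Qpoly_meas (mxmeasurable_cst 1%:M) hC _ iWi.
  move=> h; apply: (mxintegrable_eq _ (h _)) => [t _|t i k _]; first by rewrite mulmx1.
  by rewrite mxE; case: eqP => _; rewrite ?Normc.normc1 ?Normc.normc0.
rewrite /inner (@mxint_eq _ _ _ (fun t => expi 0 t *: QWinv t -
  \sum_(1 <= k < n.+1) (expi (- k%:Z) t *: QWinv t) *m (D k) ^t*)); last first.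
  move=> t ct; rewrite [in X in _ *m X]/QWinv adjmxM weight_inv_herm// mulmxA.
  rewrite mulmxK ?weight_unit// /Qpoly adjmxB adjmx1 mulmxBr mulmx1.
  rewrite expi0 scale1r; congr (_ - _).
  rewrite raddf_sum/= map_mx_sum mulmx_sumr; apply: eq_bigr => k _.
  by rewrite adjmxZ -scalemxAr -scalemxAl expiN.
rewrite mxintB//; last by apply: mxintegrable_sum => k; exact: mxintegrableMr.
rewrite coef_QWinv0 mxint_sum; last by move=> k; exact: mxintegrableMr.
rewrite big_nat big1 ?subr0// => k kn.
by rewrite mxintMr// coef_QWinv_eq0 ?mul0mx.
Qed.

Lemma X_herm : X ^t* = X.
Proof. by rewrite -inner_QWinv -(innerJ q0 hW L2_QWinv L2_QWinv). Qed.

(** If [u X u ^t* = 0], then [u Q W^-1] has norm [0], hence [u Q = 0] almost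
    everywhere and [u], the constant coefficient of [u Q], is [0]. *)
Lemma X_posdef : posdefmx X.
Proof.
split; first by apply/is_hermitianmxP; rewrite expr0 scale1r X_herm.
move=> u u0.
(* all the rows of [A] are equal to [u], which turns [u] into a square matrix *)
pose A : M := (const_mx 1 : 'cV_q) *m u.
have LA := L2M q0 hW A L2_QWinv.
have AXA i : (A *m X *m A ^t*) i i = (u *m X *m u ^t*) ord0 ord0.
  have -> : A *m X *m A ^t* =
      (const_mx 1 : 'cV_q) *m (u *m X *m u ^t*) *m (const_mx 1 : 'cV_q) ^t*.
    by rewrite adjmxM !mulmxA.
  rewrite mxE big_ord1 !mxE big_ord1 !mxE conjCc conjc1 mulr1.
  by rewrite mul1r.
have eA : A *m X *m A ^t* = inner W (fun t => A *m QWinv t) (fun t => A *m QWinv t).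
  rewrite (innerMl q0 hW A L2_QWinv LA) (innerMr q0 hW A L2_QWinv L2_QWinv).
  by rewrite inner_QWinv mulmxA.
have sA : sqnorm W (fun t => A *m QWinv t) = complex.Re ((u *m X *m u ^t*) ord0 ord0).
  rewrite (sqnormE q0 hW LA) -eA Re_ntr (eq_bigr (fun=> complex.Re ((u *m X *m u ^t*) ord0 ord0))).
    rewrite sumr_const cardT size_enum_ord -[X in _ * X]mulr_natl mulKf//.
    by rewrite pnatr_eq0 -lt0n.
  by move=> i _; rewrite AXA.
rewrite ltcE; apply/andP; split.
  have : Num.conj ((u *m X *m u ^t*) ord0 ord0) = (u *m X *m u ^t*) ord0 ord0.
    by rewrite -adjmxE !adjmxM trmxCK X_herm mulmxA.
  case: (_ ord0 ord0) => a b [] /eqP; rewrite -subr_eq0 -opprD oppr_eq0 /=.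
  by rewrite -mulr2n mulrn_eq0.
rewrite lt_neqAle -sA sqnorm_ge0// andbT; apply/eqP => /esym sA0.
have A0 : A = 0.
  rewrite -[A]mulmx1 -coef_Qpoly0 -mxintMl; last first.
    move=> i j; have [C hC] := Qpoly_bounded.
    by apply: (@cintegrable_bounded _ C) => [|t]; [exact: Qpoly_meas|exact: hC].
  rewrite -[RHS]mxint_cst; apply: mxint_ae_eq.
  - by apply: mxmeasurableM; [exact: mxmeasurable_cst|exact: Qpoly_meas].
  - exact: mxmeasurable_cst.
  - have := sqnorm_eq0 q0 hW LA sA0; apply: lam_ae_imply => t h ct.
    by have := h ct; rewrite /QWinv mulmxA => /(congr1 (mulmx^~ (W t)));
      rewrite mulmxKV ?weight_unit// mul0mx.
move/eqP: u0; apply; apply/rowP => j; have := congr1 (fun B : M => B (Ordinal q0) j) A0.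
by rewrite !mxE big_ord1 mxE mul1r.
Qed.

Lemma X_unit : X \in unitmx.
Proof. exact: posdefmx_unit X_posdef. Qed.

Lemma invX_herm : (invmx X) ^t* = invmx X.
Proof. exact: hermE (posdefmx_inv X_unit X_posdef).1. Qed.

Definition resid (t : R) : M := invmx X *m QWinv t.
Definition proj (t : R) : M := 1%:M - resid t.

Lemma L2_resid : L2 W resid.
Proof. exact: (L2M q0 hW _ L2_QWinv). Qed.

Lemma L2_idf : L2 W (idf : R -> M).
Proof.
apply: (@L2_bounded _ _ _ hW 1); first exact: mxmeasurable_cst.
by move=> t i j _; rewrite mxE; case: eqP => _; rewrite ?Normc.normc1 ?Normc.normc0.
Qed.

Lemma L2_proj : L2 W proj.
Proof. exact: (L2B q0 hW L2_idf L2_resid). Qed.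

Lemma inner_resid : inner W resid resid = invmx X.
Proof.
rewrite (innerMl q0 hW _ L2_QWinv L2_resid) (innerMr q0 hW _ L2_QWinv L2_QWinv).
rewrite inner_QWinv.
by rewrite mulmxA mulVmx ?X_unit// mul1mx invX_herm.
Qed.

(** The Fourier coefficient of [I - X^-1 Q W^-1] is [I - X^-1 X] at [0] and vanishes
    at [1, ..., n] by the linear system. *)
Lemma mul_proj_Mspace A : Mspace W (S1 n) (fun t => A *m proj t).
Proof.
apply: (@Mspace_cofinite _ _ q0 _ hW _ [seq k%:Z | k <- iota 0 n.+1]).
- move=> k; rewrite -[S1 n k]/(is_true (~~ (0 <= k <= n%:Z))).
  apply: contra => /andP[k0 kn].
  apply/mapP; exists `|k|%N; last by rewrite gez0_abs.
  by rewrite mem_iota /= add0n ltnS -lez_nat gez0_abs.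
- exact: (L2M q0 hW A L2_proj).
move=> _ /mapP[j jn ->].
have Lc := L2_charinv hW j%:Z.
rewrite -(inner_charinv hW) (innerMl q0 hW A L2_proj Lc).
rewrite (innerBl q0 hW L2_idf L2_resid Lc) (innerMl q0 hW _ L2_QWinv Lc).
rewrite !(inner_charinv hW) mxint_expi oppr_eq0.
move: jn; rewrite mem_iota /= add0n ltnS => jn.
have [->|j0] := eqVneq j 0%N.
  rewrite eqxx oppr0 coef_QWinv0 mulVmx ?X_unit// scale1r subrr.
  exact: mulmx0.
rewrite coef_QWinv_eq0 ?lt0n ?j0// mulmx0 subr0.
by rewrite eqz_nat (negPf j0) scale0r mulmx0.
Qed.

Lemma proj_Mspace : Mspace W (S1 n) proj.
Proof.
have -> : proj = fun t => 1%:M *m proj t by apply/funext => t; rewrite mul1mx.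
exact: mul_proj_Mspace.
Qed.

Lemma Mspace_L2 S F : Mspace W S F -> L2 W F.
Proof. by case. Qed.

(** [Q W^-1 W = Q] has frequencies in [{0, ..., n}] only. *)
Lemma resid_orth H : Mspace W (S1 n) H -> inner W resid H = 0.
Proof.
move=> [LH hH]; rewrite (innerJ q0 hW LH L2_resid).
suff -> : inner W H resid = 0 by rewrite trmx0 map_mx0.
apply: (inner_closure_eq0 q0 hW LH L2_resid) => e e0.
have [T [[s [A [sS eT]]] TH]] := hH e e0.
have LT : L2 W T by rewrite eT; exact: L2_trig.
exists T; split=> //.
rewrite (innerJ q0 hW L2_resid LT).
suff -> : inner W resid T = 0 by rewrite trmx0 map_mx0.
rewrite (innerMl q0 hW _ L2_QWinv LT).
suff -> : inner W QWinv T = 0 by rewrite mulmx0.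
have iQ j : mxintegrable (fun t => expi j t *: Q t).
  apply: mxintegrable_expiZ => i i'; have [C hC] := Qpoly_bounded.
  by apply: (@cintegrable_bounded _ C) => [|t]; [exact: Qpoly_meas|exact: hC].
rewrite /inner (@mxint_eq _ _ _ (fun t => \sum_(k <- s)
    (expi (- k) t *: Q t) *m (A k) ^t*)); last first.
  move=> t ct; rewrite /QWinv mulmxKV ?weight_unit// eT raddf_sum/= map_mx_sum.
  rewrite mulmx_sumr; apply: eq_bigr => k _.
  by rewrite adjmxZ -scalemxAr -scalemxAl expiN.
rewrite mxint_sum; last by move=> k; exact: mxintegrableMr.
rewrite big_seq big1// => k ks; rewrite mxintMr// coef_Qpoly_eq0 ?mul0mx//.
exact: sS.
Qed.

Lemma subK_proj t : idf t - proj t = resid t.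
Proof. by rewrite /proj subKr. Qed.

Lemma proj_is_orthproj : is_orthproj W (S1 n) idf proj.
Proof.
split; first exact: proj_Mspace.
move=> H /resid_orth <-; apply: inner_eq => // t _; exact: subK_proj.
Qed.

(** The difference of two projections of [I] is in the subspace and orthogonal to
    it. *)
Lemma orthproj_uniq G : is_orthproj W (S1 n) idf G -> G = proj %[ae lam R in circle R].
Proof.
move=> [MG hG]; have LG := Mspace_L2 MG; have LP := L2_proj.
have LI := L2_idf; have [MP hP] := proj_is_orthproj.
have Lr := L2B q0 hW LI LG; have Ls := L2B q0 hW LI LP.
have d0 H : Mspace W (S1 n) H -> inner W (fun t => G t - proj t) H = 0.
  move=> MH; have LH := Mspace_L2 MH.
  have -> : inner W (fun t => G t - proj t) H =
      inner W (fun t => (idf t - proj t) - (idf t - G t)) H.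
    apply: inner_eq => // t _.
    by move: (G t) (proj t) (idf t) => x y z; rewrite [RHS]addrC opprB addrA subrK.
  by rewrite (innerBl q0 hW Ls Lr LH) hG// hP// subrr.
have LGP := L2B q0 hW LG LP.
have : sqnorm W (fun t => G t - proj t) = 0.
  rewrite (sqnormE q0 hW LGP) (innerBr q0 hW LGP LG LP) !d0// subrr.
  by rewrite /ntr linear0 mulr0.
move=> /(sqnorm_eq0 q0 hW LGP); apply: lam_ae_imply => t h ct.
by apply/eqP; rewrite -subr_eq0; apply/eqP; exact: h.
Qed.

Lemma L2_dist A S F : Mspace W S F -> L2 W (fun t => A - F t).
Proof.
move=> /Mspace_L2; apply: (L2B q0 hW).
by have := L2M q0 hW A L2_idf; apply: (L2_eq hW) => t _; exact: mulmx1.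
Qed.

Lemma inner_mul_resid A :
  inner W (fun t => A *m resid t) (fun t => A *m resid t) = A *m invmx X *m A ^t*.
Proof.
have Lr := L2_resid; have LAr := L2M q0 hW A Lr.
by rewrite (innerMl q0 hW A Lr LAr) (innerMr q0 hW A Lr Lr) inner_resid mulmxA.
Qed.

(** Pythagoras: [A - F] is the sum of [A *m resid] and of an element of the
    subspace. *)
Lemma sqnorm_dist A F : Mspace W (S1 n) F ->
  complex.Re (ntr (A *m invmx X *m A ^t*)) <= sqnorm W (fun t => A - F t).
Proof.
move=> MF; have LF := Mspace_L2 MF; have Lr := L2_resid.
have MA := mul_proj_Mspace A; have LA := Mspace_L2 MA.
have LAr := L2M q0 hW A Lr; have LK := L2B q0 hW LF LA.
have o : inner W (fun t => A *m resid t) (fun t => F t - A *m proj t) = 0.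
  rewrite (innerMl q0 hW A Lr LK) (innerBr q0 hW Lr LF LA).
  by rewrite (resid_orth MF) (resid_orth MA) subrr mulmx0.
have eAF t : A - F t = A *m resid t - (F t - A *m proj t).
  rewrite /proj mulmxBr mulmx1; move: (A *m resid t) (F t) => x y.
  by rewrite opprB addrA [x + _]addrC subrK.
rewrite (_ : (fun t => A - F t) = fun t => A *m resid t - (F t - A *m proj t)); last first.
  by apply/funext => t.
have LAF := L2B q0 hW LAr LK.
rewrite (sqnormE q0 hW LAF) (innerBl q0 hW LAr LK LAF).
rewrite (innerBr q0 hW LAr LAr LK) o subr0 (innerBr q0 hW LK LAr LK).
rewrite (innerJ q0 hW LAr LK) o trmx0 map_mx0 sub0r opprK.
have sK := sqnorm_ge0 hW (fun t => F t - A *m proj t).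
rewrite (sqnormE q0 hW LK) in sK; rewrite ntrD cReD inner_mul_resid.
by rewrite lerDl.
Qed.

Lemma sqnorm_dist_proj A :
  sqnorm W (fun t => A - A *m proj t) = complex.Re (ntr (A *m invmx X *m A ^t*)).
Proof.
have Lr := L2_resid; have LAr := L2M q0 hW A Lr.
rewrite (_ : (fun t => A - A *m proj t) = fun t => A *m resid t); last first.
  by apply/funext => t; rewrite /proj mulmxBr mulmx1 subKr.
by rewrite (sqnormE q0 hW LAr) inner_mul_resid.
Qed.

(** The lower bound [sqnorm_dist] is minimized over [A] by [root_det_le_ntr] and
    [root_det_attained]. *)
Lemma deltaE : (delta W (S1 n))%:C = (q.-root (\det X))^-1.
Proof.
have pY := posdefmx_inv X_unit X_posdef; set Y := invmx X in pY.
have dX : 0 <= \det X.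
  have [P [d [PP PP' d0 ->]]] := posdefmx_spectral X_posdef.
  rewrite -mulmxA mulmxA !det_mulmx mulrAC -det_mulmx PP' det1 mul1r det_diag.
  by apply: prodr_ge0 => i _; exact: ltW.
have rE : (q.-root (\det X))^-1 = q.-root (\det Y) by rewrite -rootCV// det_inv.
pose r := complex.Re (q.-root (\det Y)).
have rC : r%:C = q.-root (\det Y).
  rewrite RRe_real// ger0_real// rootC_ge0//.
  by rewrite det_inv invr_ge0.
rewrite rE -rC; congr (_%:C).
have [A0 dA0 eA0] := root_det_attained q0 pY.
have rS : [set x | exists A : M, exists F : R -> M,
    [/\ \det A = 1, Mspace W (S1 n) F & x = nrm W (fun t => A - F t) ^+ 2]] r.
  exists A0, (fun t => A0 *m proj t); split=> //; first exact: mul_proj_Mspace.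
  rewrite (nrm2E q0 hW (L2_dist A0 (mul_proj_Mspace A0))).
  by rewrite sqnorm_dist_proj eA0.
have lb : lbound [set x | exists A : M, exists F : R -> M,
    [/\ \det A = 1, Mspace W (S1 n) F & x = nrm W (fun t => A - F t) ^+ 2]] r.
  move=> _ [A [F [dA MF ->]]].
  rewrite (nrm2E q0 hW (L2_dist A MF)).
  apply: (le_trans _ (sqnorm_dist A MF)).
  have uA : A \in unitmx by rewrite unitmxE dA unitr1.
  have := root_det_le_ntr q0 (posdefmx_congr uA pY); rewrite det_conj//.
  by rewrite lecE => /andP[].
apply/eqP; rewrite eq_le; apply/andP; split.
- by apply: ge_inf => //; exists r.
- by apply: lb_le_inf => //; exists r.
Qed.

End Projection.

Unset Implicit Arguments.

Theorem theorem4p2 (R : realType) (q : nat) (hq : (0 < q)%N)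
    (n : nat) (hn : (0 < n)%N)
    (W : R -> 'M[R[i]]_q) (hW : weight W)
    (D : nat -> 'M[R[i]]_q)
    (hD : forall j : nat, (1 <= j <= n)%N ->
       \sum_(1 <= k < n.+1) Ccoef W (j%:Z - k%:Z) *m (D k) ^t*
         = Ccoef W j%:Z) :
  let X := inner_inv W (Qpoly n D) idf in
  [/\ X \in unitmx,
      is_orthproj W (S1 n) idf (orthproj W (S1 n) idf),
      orthproj W (S1 n) idf =
        (fun t => 1%:M - invmx X *m Qpoly n D t *m invmx (W t))
        %[ae lam R in circle R],
      Delta W (S1 n) = invmx X &
      (delta W (S1 n))%:C = (q.-root (\det X))^-1].
Proof.
move=> X; have hP := proj_is_orthproj hq hW hD.
have hO : is_orthproj W (S1 n) idf (orthproj W (S1 n) idf).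
  by apply: (@xgetPex _ _ [set G | is_orthproj W (S1 n) idf G]); exists (proj W n D).
have ae := orthproj_uniq hq hW hD hO.
have LI := @L2_idf _ q W hW.
split=> //.
- exact: X_unit.
- apply: lam_ae_imply ae => t h ct; rewrite (h ct) /proj /resid /QWinv mulmxA.
  by [].
- rewrite -[RHS](inner_resid hq hW hD); apply: inner_ae_eq => //.
  + apply: L2_meas; apply: (L2B hq hW LI); exact: Mspace_L2 hO.1.
  + exact: L2_meas (L2_resid hq hW _ _).
  + by apply: lam_ae_imply ae => t h ct; rewrite h// subK_proj.
- exact: deltaE.
Qed.
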